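(* Let $\mathscr{K}$ be an open convex cone in $\mathbb{R}^n$ with lineality space $L_\mathscr{K}$, and let $f\in\mathbb{R}[t_1,\dots,t_n]$ be homogeneous of degree $d\ge2$. Then $f$ is in the interior of $\mathrm{L}^d_n(\mathscr{K})\subset\mathrm{H}^d_n(\mathscr{K})$ if and only if for all $\mathbf{v}_1,\dots,\mathbf{v}_d\in S_\mathscr{K}/L_\mathscr{K}$: (PC) $D_{\mathbf{v}_1}\cdots D_{\mathbf{v}_d}f>0$, and (HC) the symmetric bilinear form $(\mathbf{x},\mathbf{y})\mapsto D_\mathbf{x}D_\mathbf{y}D_{\mathbf{v}_3}\cdots D_{\mathbf{v}_d}f$ has exactly one positive eigenvalue and kernel equal to $L_\mathscr{K}$.
   Context: $D_\mathbf{u}=\sum u_i\partial_i$. $L_\mathscr{K}=\overline{\mathscr{K}}\cap-\overline{\mathscr{K}}$. $S_\mathscr{K}$ is the set of unit vectors generating extreme rays of $\overline{\mathscr{K}}$, and $S_\mathscr{K}/L_\mathscr{K}$ is the set of vectors of $S_\mathscr{K}$ orthogonal to $L_\mathscr{K}$. $\mathrm{H}^d_n(\mathscr{K})$ is the linear space of homogeneous degree-$d$ polynomials $g$ with $D_\mathbf{w}g\equiv0$ for all $\mathbf{w}\in L_\mathscr{K}$ (Euclidean topology). $\mathrm{L}^d_n(\mathscr{K})$ is the set of $\mathscr{K}$-Lorentzian polynomials of degree $d$, where homogeneous $g$ of degree $d\ge1$ is $\mathscr{K}$-Lorentzian if for all $\mathbf{v}_1,\dots,\mathbf{v}_d\in\mathscr{K}$,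 $D_{\mathbf{v}_1}\cdots D_{\mathbf{v}_d}g>0$ and (if $d\ge2$) $(\mathbf{x},\mathbf{y})\mapsto D_\mathbf{x}D_\mathbf{y}D_{\mathbf{v}_3}\cdots D_{\mathbf{v}_d}g$ has exactly one positive eigenvalue.
   Formalization: The cone is assumed different from R^n and f is assumed to lie in H^d_n(K); without either the equivalence fails (K=R^n; or K={x_1>0} in R^2, f=t_1^3+t_2^3). Extreme rays are understood modulo the lineality space. *)

(* Defs.v *)
From mathcomp Require Import all_boot all_order all_algebra.
From mathcomp Require Import all_classical all_reals all_analysis.
From mathcomp Require Import -(notations) mpoly.

Set Implicit Arguments.
Unset Strict Implicit.
Unset Printing Implicit Defensive.

Import Order.TTheory GRing.Theory Num.Theory.
Import numFieldNormedType.Exports.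

Local Open Scope classical_set_scope.
Local Open Scope ring_scope.

(* The notations of the mpoly file clash with those of MathComp-Analysis and
   are not imported: [mpoly n R] is {mpoly R[n]}, [mcoeff m p] is p@_m,
   [mderiv i p] is p^`M(i) and [ishomog1 d mdeg] is d.-homog. *)

Definition homogeneous (R : realType) (n d : nat) (p : mpoly n R) : Prop :=
  p \is ishomog1 d (@mdeg n).

Definition dirderiv (R : realType) (n : nat) (u : 'rV[R]_n) (p : mpoly n R) :
    mpoly n R :=
  \sum_(i < n) u 0 i *: mderiv i p.

Definition dirderivs (R : realType) (n : nat) (v : seq 'rV[R]_n)
    (p : mpoly n R) : mpoly n R :=
  foldr (@dirderiv R n) p v.

(* A d-fold derivative of a homogeneous polynomial of degree d is a constant
   polynomial; [dirval v p] is that constant, for d = size v. *)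
Definition dirval (R : realType) (n : nat) (v : seq 'rV[R]_n)
    (p : mpoly n R) : R :=
  mcoeff (@mnm0 n) (dirderivs v p).

Definition dirform (R : realType) (n : nat) (v : seq 'rV[R]_n)
    (p : mpoly n R) (x y : 'rV[R]_n) : R :=
  dirval [:: x, y & v] p.

Definition gram (R : realType) (n : nat) (B : 'rV[R]_n -> 'rV[R]_n -> R) :
    'M[R]_n :=
  \matrix_(i, j) B (delta_mx 0 i) (delta_mx 0 j).

(* Eigenvalues of a symmetric bilinear form are those of its matrix in the
   standard basis, counted with multiplicity.  The matrix being symmetric, the
   multiplicity of an eigenvalue is the dimension of its eigenspace. *)
Definition one_positive_eigenvalue (R : realType) (n : nat)
    (B : 'rV[R]_n -> 'rV[R]_n -> R) : Prop :=
  exists a : R,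
    [/\ 0 < a,
        \rank (eigenspace (gram B) a) = 1%N
      & forall b : R, 0 < b -> eigenvalue (gram B) b -> b = a].

Definition form_kernel (R : realType) (n : nat)
    (B : 'rV[R]_n -> 'rV[R]_n -> R) : set 'rV[R]_n :=
  [set x | forall y, B x y = 0].

Definition dot (R : realType) (n : nat) (x y : 'rV[R]_n) : R :=
  \sum_(i < n) x 0 i * y 0 i.

Definition open_convex_cone (R : realType) (n : nat) (K : set 'rV[R]_n) :
    Prop :=
  [/\ open K, convex_set K & forall c x, 0 < c -> K x -> K (c *: x)].

Definition lineality (R : realType) (n : nat) (K : set 'rV[R]_n) :
    set 'rV[R]_n :=
  [set x | closure K x /\ closure K (- x)].

(* Every face of [closure K] contains the lineality space, so if the latter is
   nonzero then extreme rays are understood modulo it: v generates an extreme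
   ray when v is not in the lineality space L and L + R_{>=0} v is a face.
   If L = 0 this is the usual notion. *)
Definition extreme_direction (R : realType) (n : nat) (K : set 'rV[R]_n)
    (v : 'rV[R]_n) : Prop :=
  [/\ closure K v, ~ lineality K v
    & forall x y, closure K x -> closure K y -> x + y = v ->
        exists2 c : R, 0 <= c & lineality K (x - c *: v)].

Definition extreme_vectors (R : realType) (n : nat) (K : set 'rV[R]_n) :
    set 'rV[R]_n :=
  [set v | dot v v = 1 /\ extreme_direction K v].

Definition extreme_vectors_mod (R : realType) (n : nat) (K : set 'rV[R]_n) :
    set 'rV[R]_n :=
  [set v | extreme_vectors K v /\ forall w, lineality K w -> dot v w = 0].

Definition Hspace (R : realType) (n d : nat) (K : set 'rV[R]_n) :
    set (mpoly n R) :=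
  [set g | homogeneous d g /\ forall w, lineality K w -> dirderiv w g = 0].

Definition Lorentzian (R : realType) (n d : nat) (K : set 'rV[R]_n) :
    set (mpoly n R) :=
  [set g | [/\ (1 <= d)%N, homogeneous d g
    & forall v : d.-tuple 'rV[R]_n, (forall u, u \in v -> K u) ->
        0 < dirval v g /\
        ((2 <= d)%N -> one_positive_eigenvalue (dirform (drop 2 v) g))]].

(* Interior relative to Hspace d K, a finite-dimensional space whose Euclidean
   topology is that of the largest absolute value of the coefficients. *)
Definition interior_in_Hspace (R : realType) (n d : nat) (K : set 'rV[R]_n)
    (A : set (mpoly n R)) : set (mpoly n R) :=
  [set f | Hspace d K f /\
    exists2 e : R, 0 < e &
      forall g : mpoly n R, Hspace d K g ->
        (forall m : multinom n,
          `|mcoeff m g - mcoeff m f| < e) -> A g].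

(* Main.v *)
(* Hyperbolicity of a symmetric form [B] (one positive eigenvalue) means that
   [B] is nonpositive on the [B]-orthogonal complement of a vector [u] with
   [B u u > 0].

   From right to left, both conditions first pass from extreme rays to all of
   [closure K] minus the lineality space [L]: by Minkowski's theorem it suffices
   to treat sums, and if [A], [B] are the forms attached to [a :: r], [b :: r],
   then [A b = B a] by symmetry of mixed derivatives, so that [A + B], the form
   attached to [a + b :: r], is nonpositive on the hyperplane [A b = 0], with
   null vectors in [L] only.  The set of extreme rays need not be closed, but the
   unit vectors of [closure K] orthogonal to [L] form a compact set, on which
   the extended conditions are uniform and so persist under small perturbations
   of the polynomial within the ambient space.

   From left to right, the weak forms of both inequalities hold at the boundary
   by continuity; adding and subtracting a small multiple of the power [l ^+ d] of
   a generic linear form [l] vanishing on [L] makes them strict. *)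
Require Import Defs.
From mathcomp Require Import all_boot all_order all_algebra.
From mathcomp Require Import all_classical all_reals all_analysis.
From mathcomp Require Import -(notations) mpoly.
From mathcomp Require Import ring lra.

Set Implicit Arguments.
Unset Strict Implicit.
Unset Printing Implicit Defensive.

Import Order.TTheory GRing.Theory Num.Theory.
Import numFieldNormedType.Exports.
Local Open Scope classical_set_scope.
Local Open Scope ring_scope.

(** * Symmetric bilinear forms with one positive eigenvalue *)

Section SymmetricForms.
Variables (R : realType) (n : nat).
Local Notation V := 'rV[R]_n.
Implicit Types (B D : V -> V -> R) (x y z u : V) (L : set V).

Definition symbilin B :=
  (forall x y, B x y = B y x) /\
  (forall a x y z, B (a *: x + y) z = a * B x z + B y z).

Lemma symbilin_lin B : symbilin B -> forall a b x y z,
  B (a *: x + b *: y) z = a * B x z + b * B y z.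
Proof.
move=> [_ Bl] a b x y z; rewrite Bl; congr (_ + _).
have B0 : B 0 z = 0.
  by have := Bl 1 0 0 z; rewrite scale1r addr0 mul1r => e; lra.
by rewrite -[b *: y]addr0 Bl B0 addr0.
Qed.

Lemma symbilin_quad B : symbilin B -> forall a b x y,
  B (a *: x + b *: y) (a *: x + b *: y) =
  a ^+ 2 * B x x + 2 * a * b * B x y + b ^+ 2 * B y y.
Proof.
move=> Bs a b x y; have BC := Bs.1; have Bl := symbilin_lin Bs.
by rewrite Bl !(BC _ (a *: x + b *: y)) !Bl (BC y x); ring.
Qed.

Lemma symbilin0l B : symbilin B -> forall z, B 0 z = 0.
Proof.
by move=> Bs z; have := symbilin_lin Bs 0 0 0 0 z; rewrite !scale0r !addr0 !mul0r addr0.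
Qed.

Lemma symbilinZ B : symbilin B -> forall a x z, B (a *: x) z = a * B x z.
Proof.
by move=> Bs a x z; have := symbilin_lin Bs a 0 x 0 z; rewrite !scale0r !addr0 !mul0r addr0.
Qed.

Lemma symbilinD B : symbilin B -> forall x y z, B (x + y) z = B x z + B y z.
Proof.
by move=> Bs x y z; have := symbilin_lin Bs 1 1 x y z; rewrite !scale1r !mul1r.
Qed.

Lemma symbilin_suml B : symbilin B -> forall (I : Type) (r : seq I) (F : I -> V) z,
  B (\sum_(i <- r) F i) z = \sum_(i <- r) B (F i) z.
Proof.
move=> Bs I r F z; elim: r => [|i r IH]; first by rewrite !big_nil (symbilin0l Bs).
by rewrite !big_cons (symbilinD Bs) IH.
Qed.

Lemma dot_symbilin : symbilin (@dot R n).
Proof.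
split=> [x y|a x y z]; rewrite /dot; first by apply: eq_bigr => i _; rewrite mulrC.
rewrite mulr_sumr -big_split /=; apply: eq_bigr => i _.
by rewrite !mxE; ring.
Qed.

Lemma dot_ge0 x : 0 <= dot x x.
Proof. by apply: sumr_ge0 => i _; rewrite -expr2 sqr_ge0. Qed.

Lemma dot_eq0 x : dot x x = 0 -> x = 0.
Proof.
move=> /eqP; rewrite /dot psumr_eq0; last by move=> i _; rewrite -expr2 sqr_ge0.
move=> /allP x0; apply/rowP => i; rewrite mxE.
by have := x0 i (mem_index_enum i); rewrite -expr2 sqrf_eq0 => /eqP.
Qed.

Lemma dot_gt0 x : x != 0 -> 0 < dot x x.
Proof.
move=> x0; rewrite lt_neqAle dot_ge0 andbT eq_sym.
by apply: contra x0 => /eqP /dot_eq0 ->.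
Qed.

Lemma dot_delta x i : dot x (delta_mx 0 i) = x 0 i.
Proof.
rewrite /dot (bigD1 i) //= big1 => [|j /negPf ji]; last by rewrite !mxE ji mulr0.
by rewrite !mxE !eqxx mulr1 addr0.
Qed.

Lemma unit_scaling x : x != 0 ->
  exists c : R, 0 < c /\ dot (c *: x) (c *: x) = 1.
Proof.
move=> /dot_gt0 x0; exists (Num.sqrt (dot x x))^-1.
have s0 : 0 < Num.sqrt (dot x x) by rewrite sqrtr_gt0.
split; first by rewrite invr_gt0.
rewrite (symbilinZ dot_symbilin) dot_symbilin.1 (symbilinZ dot_symbilin).
have -> : dot x x = Num.sqrt (dot x x) ^+ 2 by rewrite sqr_sqrtr // ltW.
rewrite sqrtr_sqr gtr0_norm //.
by field; rewrite gt_eqF.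
Qed.

Lemma symbilin_expand B : symbilin B -> forall x y,
  B x y = \sum_(i < n) x 0 i * \sum_(j < n) y 0 j * B (delta_mx 0 i) (delta_mx 0 j).
Proof.
move=> Bs x y; rewrite [in LHS](row_sum_delta x) (symbilin_suml Bs).
apply: eq_bigr => i _; rewrite (symbilinZ Bs) Bs.1; congr (_ * _).
rewrite [in LHS](row_sum_delta y) (symbilin_suml Bs).
by apply: eq_bigr => j _; rewrite (symbilinZ Bs) Bs.1.
Qed.

Lemma continuous_sum (T : topologicalType) (I : Type) (r : seq I) (F : I -> T -> R) :
  (forall i, continuous (F i)) -> continuous (fun t => \sum_(i <- r) F i t).
Proof.
move=> Fc t; elim: r => [|i r IH].
  under eq_fun do rewrite big_nil; exact: cvg_cst.
under eq_fun do rewrite big_cons.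
by rewrite ?big_cons; apply: cvgD => //; exact: Fc.
Qed.

Lemma continuous_symbilin B (T : topologicalType) (f g : T -> V) : symbilin B ->
  (forall i, continuous (fun t => f t 0 i)) ->
  (forall i, continuous (fun t => g t 0 i)) ->
  continuous (fun t => B (f t) (g t)).
Proof.
move=> Bs fc gc; under eq_fun do rewrite (symbilin_expand Bs).
apply: continuous_sum => i t; apply: cvgM; first exact: fc.
apply: continuous_sum => j {}t; apply: cvgM; first exact: gc.
exact: cvg_cst.
Qed.

Lemma mul_gram B x i : symbilin B -> (x *m gram B) 0 i = B x (delta_mx 0 i).
Proof.
move=> Bs; rewrite mxE [in RHS](row_sum_delta x) (symbilin_suml Bs).
by apply: eq_bigr => j _; rewrite mxE (symbilinZ Bs).
Qed.

(** Lets eigenvectors be handled through the form and the dot product rather than through the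
    matrix. *)
Lemma eigenspace_gramP B a x : symbilin B ->
  (x <= eigenspace (gram B) a)%MS <-> forall y, B x y = a * dot x y.
Proof.
move=> Bs; split.
  move=> /eigenspaceP xB y; rewrite Bs.1 dot_symbilin.1 (row_sum_delta y).
  rewrite (symbilin_suml Bs) (symbilin_suml dot_symbilin) mulr_sumr.
  apply: eq_bigr => j _.
  rewrite (symbilinZ Bs) (symbilinZ dot_symbilin) Bs.1 dot_symbilin.1.
  by rewrite -mul_gram // xB mxE dot_delta mulrCA.
move=> xB; apply/eigenspaceP/rowP => i.
by rewrite mul_gram // xB dot_delta mxE.
Qed.

(* Test the form at [x + t y] with [t = - D x y / (D y y + 1)]. *)
Lemma psd_null_orthogonal D x y : symbilin D -> D x x = 0 ->
  (forall t, 0 <= D (x + t *: y) (x + t *: y)) -> 0 <= D y y -> D x y = 0.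
Proof.
move=> Ds Dxx Dge Dyy.
set q := D y y in Dyy; set p := D x y.
have q1 : 0 < q + 1 by lra.
have := Dge (- p / (q + 1)).
rewrite -[X in X + _]scale1r (symbilin_quad Ds) Dxx -/p -/q.
have -> : 1 ^+ 2 * 0 + 2 * 1 * (- p / (q + 1)) * p + (- p / (q + 1)) ^+ 2 * q
  = - (p ^+ 2 * (q + 2) / (q + 1) ^+ 2) by field; rewrite gt_eqF.
rewrite oppr_ge0 => h; apply/eqP; rewrite -sqrf_eq0; apply/eqP/le_anti.
rewrite sqr_ge0 andbT -(@pmulr_lle0 _ ((q + 2) / (q + 1) ^+ 2)).
  by rewrite mulrA.
by rewrite divr_gt0 ?exprn_gt0 //; lra.
Qed.

Lemma unit_coord_le1 x i : dot x x = 1 -> `|x 0 i| <= 1.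
Proof.
move=> x1; rewrite -ler_sqr ?nnegrE // expr1n real_normK ?num_real // -x1.
rewrite /dot (bigD1 i) //= -expr2 lerDl.
by apply: sumr_ge0 => j _; rewrite -expr2 sqr_ge0.
Qed.

Lemma compact_unit_vectors (A : set V) :
  closed A -> (forall x, A x -> dot x x = 1) -> compact A.
Proof.
move=> Ac A1.
have cube : compact [set v : V | forall i, v ord0 i \in `[-1, 1]].
  by apply: (@rV_compact R n (fun=> `[-1, 1]%classic)); move=> _; exact: segment_compact.
apply: subclosed_compact Ac cube _ => x /A1 x1 i /=.
by rewrite in_itv /= -ler_norml; exact: unit_coord_le1.
Qed.

Lemma continuous_coord i : continuous (fun x : V => x 0 i).
Proof. exact: coord_continuous. Qed.

Lemma closed_unit_sphere : closed [set x : V | dot x x = 1].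
Proof.
have c : continuous (fun x : V => dot x x).
  apply: continuous_symbilin => [|i|i]; [exact: dot_symbilin| |];
    exact: continuous_coord.
apply: (@preimage_closed _ _ (fun x : V => dot x x) [set r : R | r = 1]); last exact: closed_eq.
by move=> x _; exact: c.
Qed.

Lemma closed_dot0 e : closed [set x : V | dot e x = 0].
Proof.
have c : continuous (fun x : V => dot e x).
  apply: continuous_symbilin => [|i|i].
  - exact: dot_symbilin.
  - exact: cst_continuous.
  - exact: continuous_coord.
apply: (@preimage_closed _ _ (fun x : V => dot e x) [set r : R | r = 0]); last exact: closed_eq.
by move=> x _; exact: c.
Qed.

(** Rayleigh quotient: a maximum of [B x x] over the unit vectors orthogonal to [e] is an
    eigenvector on that complement, and on the whole space because [e] is itself an eigenvector. The
    choice [e = 0] removes the constraint. *)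
Lemma positive_eigenvector B e : symbilin B ->
  (exists a, forall y, B e y = a * dot e y) ->
  (exists2 x, dot e x = 0 & 0 < B x x) ->
  exists b x, [/\ 0 < b, x != 0, dot e x = 0 & forall y, B x y = b * dot x y].
Proof.
move=> Bs [a eB] [x0 ex0 Bx0].
have dC := dot_symbilin.1; have dZ := symbilinZ dot_symbilin.
pose A : set V := [set x | dot x x = 1] `&` [set x | dot e x = 0].
have Ac : compact A.
  apply: compact_unit_vectors => [|x []//].
  by apply: closedI; [exact: closed_unit_sphere|exact: closed_dot0].
have unitA x : x != 0 -> dot e x = 0 -> exists c : R, 0 < c /\ A (c *: x).
  move=> /unit_scaling [c [c0 c1]] ex; exists c; split => //; split => //=.
  by rewrite dC dZ dC ex mulr0.
have BZ c x : B (c *: x) (c *: x) = c ^+ 2 * B x x.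
  by rewrite (symbilinZ Bs) Bs.1 (symbilinZ Bs) mulrA.
have x00 : x0 != 0.
  by apply/eqP => x00; move: Bx0; rewrite x00 (symbilin0l Bs) ltxx.
have [c0 [c0_gt0 Ac0]] := unitA _ x00 ex0.
have Bc : continuous (fun x => B x x).
  by apply: continuous_symbilin => // i; exact: continuous_coord.
have [|x xA xmax] := compact_EVT_max _ Ac (continuous_subspaceT Bc).
  by exists (c0 *: x0).
have {xA}[/= x1 ex] : A x by rewrite -inE.
have b0 : 0 < B x x.
  apply: lt_le_trans (xmax (c0 *: x0) _); last by rewrite inE.
  by rewrite BZ mulr_gt0 // exprn_gt0.
exists (B x x), x; split => //.
  by apply/eqP => xz; move: x1; rewrite xz (symbilin0l dot_symbilin) => /esym/eqP; rewrite oner_eq0.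
(* By maximality [D] is positive semidefinite on the complement of [e], and [x] is a null vector of
   it, hence in its radical there. *)
pose D y z := B x x * dot y z - B y z.
have Ds : symbilin D.
  split=> [y z|c y z w]; rewrite /D; first by rewrite dC Bs.1.
  by rewrite (symbilinD dot_symbilin) (symbilinD Bs) dZ (symbilinZ Bs); ring.
have Dge y : dot e y = 0 -> 0 <= D y y.
  move=> ey; have [->|y0] := eqVneq y 0; first by rewrite (symbilin0l Ds).
  have [c [cgt0 cA]] := unitA _ y0 ey.
  have := xmax (c *: y); rewrite inE => /(_ cA); rewrite BZ.
  have [/= cc _] := cA; have {cc} : c ^+ 2 * dot y y = 1 by rewrite -cc dZ dC dZ mulrA.
  move=> cc; rewrite -[X in _ <= X]mulr1 -cc mulrCA.
  by rewrite ler_pM2l ?exprn_gt0 // /D subr_ge0.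
have Dxy y : dot e y = 0 -> D x y = 0.
  move=> ey; apply: (psd_null_orthogonal Ds) => [|t|]; last exact: Dge.
    by rewrite /D x1 mulr1 subrr.
  apply: Dge; rewrite dC (symbilinD dot_symbilin) dZ dC ex dC ey; ring.
(* Split off the component of [y] along [e]; if [e = 0] the value of the quotient is immaterial,
   since it multiplies [e]. *)
move=> y; pose c := dot e y / dot e e.
have ez : dot e (y - c *: e) = 0.
  rewrite dC -scaleNr (symbilinD dot_symbilin) dZ dC /c.
  have [->|e0] := eqVneq e 0; first by rewrite !(symbilin0l dot_symbilin) mulr0 addr0.
  by field; rewrite gt_eqF // dot_gt0.
have Dxe : D x e = 0 by rewrite /D Bs.1 eB dC ex !mulr0 subrr.
have : D x y = 0.
  rewrite -[y](subrK (c *: e)) Ds.1 (symbilinD Ds) (symbilinZ Ds) Ds.1 Dxy //.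
  by rewrite Ds.1 Dxe mulr0 addr0.
by move/eqP; rewrite subr_eq0 => /eqP.
Qed.

(** For [L] inside the kernel, a spectrum-free counterpart of having one positive eigenvalue and
    kernel [L]: a test on a single hyperplane is easier to add and to perturb than eigenvalues. *)
Definition hyperbolic B L u :=
  0 < B u u /\ forall x, B u x = 0 -> B x x <= 0 /\ (B x x = 0 -> L x).

(** If [e] spans the positive eigenspace, a positive vector orthogonal to [e] would yield a second
    positive eigenvector. So [B] is nonpositive on the complement of [e], and this carries over to
    the [B]-complement of any positive [u]. *)
Lemma one_positive_eigenvalue_nonpos B u x : symbilin B ->
  one_positive_eigenvalue (B) -> 0 < B u u -> B u x = 0 -> B x x <= 0.
Proof.
move=> Bs [a [a0 /eqP ra amax]] Buu Bux.
have BC := Bs.1; have BZ := symbilinZ Bs; have dC := dot_symbilin.1.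
have /rowV0Pn [e /(eigenspace_gramP _ _ Bs) eB e0] : eigenspace (gram B) a != 0.
  by rewrite -mxrank_eq0 (eqP ra).
have neg y : B e y = 0 -> B y y <= 0.
  move=> Bey; rewrite leNgt; apply/negP => By.
  have ey : dot e y = 0.
    by move: Bey; rewrite eB => /eqP; rewrite mulf_eq0 gt_eqF //= => /eqP.
  have [||b [z [b0 z0 ez zB]]] := @positive_eigenvector B e Bs.
  - by exists a.
  - by exists y.
  have zb : (z <= eigenspace (gram B) b)%MS by apply/eigenspace_gramP.
  have ba : b = a.
    apply: amax => //; rewrite /eigenvalue; apply: contra z0 => /eqP E.
    by move: zb; rewrite E submx0.
  (* The eigenspace is a line, so [e] would be a multiple of the orthogonal vector [z]. *)
  have : (e <= z)%MS.
    have zE : (z <= eigenspace (gram B) a)%MS by rewrite -ba.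
    have eE : (e <= eigenspace (gram B) a)%MS by apply/eigenspace_gramP.
    have E : (z == eigenspace (gram B) a)%MS.
      by rewrite -(geq_leqif (mxrank_leqif_eq zE)) (eqP ra) lt0n mxrank_eq0.
    by rewrite (eqmxP E).
  move=> /sub_rVP [k ek]; move: ez; rewrite ek (symbilinZ dot_symbilin) => /eqP.
  rewrite mulf_eq0 => /orP[/eqP k0|/eqP /dot_eq0 zz].
    by move: e0; rewrite ek k0 scale0r eqxx.
  by move: z0; rewrite zz eqxx.
(* Two B-orthogonal positive vectors would span a plane meeting e^perp. *)
rewrite leNgt; apply/negP => Bxx.
have := neg (B e x *: u + (- B e u) *: x).
rewrite BC (symbilin_lin Bs) (BC u e) (BC x e).
have -> : B e x * B e u + - B e u * B e x = 0 by ring.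
move=> /(_ erefl); rewrite (symbilin_quad Bs) Bux mulr0 addr0 sqrrN.
have p1 : 0 <= B e x ^+ 2 * B u u by rewrite mulr_ge0 ?sqr_ge0 // ltW.
have p2 : 0 <= B e u ^+ 2 * B x x by rewrite mulr_ge0 ?sqr_ge0 // ltW.
move=> le0.
have : B e u ^+ 2 * B x x = 0 by lra.
move/eqP; rewrite mulf_eq0 (gt_eqF Bxx) orbF sqrf_eq0 => /eqP Beu.
by have := neg u Beu; rewrite leNgt Buu.
Qed.

(** On the [B]-complement of [u] the form [- B] is positive semidefinite, so a null vector there is
    [B]-orthogonal to the whole complement, and to [u] as well: it lies in the kernel. *)
Lemma one_positive_eigenvalue_hyperbolic B L u : symbilin B ->
  one_positive_eigenvalue B -> form_kernel B = L -> 0 < B u u -> hyperbolic B L u.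
Proof.
move=> Bs B1 BL Buu; split => // x Bux.
have neg := fun x => one_positive_eigenvalue_nonpos (x := x) Bs B1 Buu.
split; first exact: neg.
move=> Bxx; rewrite -BL => y.
have BC := Bs.1; have BZ := symbilinZ Bs.
pose N y z := - B y z.
have Ns : symbilin N.
  by split=> [v w|a v w z]; rewrite /N; [rewrite BC|rewrite Bs.2; ring].
pose y' := y - (B u y / B u u) *: u.
have Buy' : B u y' = 0.
  by rewrite BC /y' -scaleNr (symbilinD Bs) BZ BC; field; rewrite gt_eqF.
have : N x y' = 0.
  apply: (psd_null_orthogonal Ns) => [|t|]; rewrite /N ?Bxx ?oppr0 // oppr_ge0; apply: neg => //.
  by rewrite BC (symbilinD Bs) BZ BC Bux BC Buy'; ring.
rewrite /N /y' BC -scaleNr (symbilinD Bs) BZ Bux mulr0 addr0 BC => /eqP.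
by rewrite oppr_eq0 => /eqP.
Qed.

(** Reverse Cauchy-Schwarz inequality: the component of [x] that is [B]-orthogonal to [u] has a
    nonpositive square. *)
Lemma hyperbolic_rcs B L u x : symbilin B -> hyperbolic B L u ->
  B x x * B u u <= B u x ^+ 2.
Proof.
move=> Bs [Buu neg]; have BC := Bs.1.
have [|le0 _] := neg (1 *: x + - (B u x / B u u) *: u).
  by rewrite BC (symbilin_lin Bs) (BC x); field; rewrite gt_eqF.
move: le0; rewrite (symbilin_quad Bs) (BC x u) => le0.
have := mulr_ge0_le0 (ltW Buu) le0; rewrite -(subr_le0 (B u x ^+ 2)); congr (_ <= _).
by field; rewrite gt_eqF.
Qed.

(** A positive eigenvector [e] exists because [B u u > 0]. Nonpositivity is transferred from the
    [B]-complement of [u] to the complement of [e], which excludes any further positive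
    eigenvector. *)
Lemma hyperbolic_one_positive_eigenvalue B L u : symbilin B ->
  (forall x y, L x -> B x y = 0) -> hyperbolic B L u ->
  one_positive_eigenvalue B /\ form_kernel B = L.
Proof.
move=> Bs LB [Buu neg]; have BC := Bs.1; have BZ := symbilinZ Bs.
have dC := dot_symbilin.1; have dZ := symbilinZ dot_symbilin.
split; last first.
  apply/seteqP; split=> x /= => [xB|Lx y]; last exact: LB.
  by apply: (neg x _).2; rewrite ?xB // BC xB.
have [||a [e [a0 e0 _ eB]]] := @positive_eigenvector B 0 Bs.
- by exists 0 => y; rewrite (symbilin0l Bs) mul0r.
- by exists u => //; rewrite (symbilin0l dot_symbilin).
have Bee : 0 < B e e by rewrite eB mulr_gt0 // dot_gt0.
have Bue : B u e != 0.
  by apply/eqP => h; have := (neg _ h).1; rewrite leNgt Bee.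
have nege y : dot e y = 0 -> B y y <= 0.
  move=> ey; have Bey : B e y = 0 by rewrite eB ey mulr0.
  (* A multiple of [e] moves [y] into the hyperplane of [u]; as [B e y = 0], this only adds a
     nonnegative multiple of [B e e] to [B y y]. *)
  have := (neg (1 *: y + - (B u y / B u e) *: e) _).1.
  rewrite BC (symbilin_lin Bs) (BC y) (BC e) (symbilin_quad Bs) (BC y e) Bey.
  have -> : 1 * B u y + - (B u y / B u e) * B u e = 0 by field.
  move=> /(_ erefl); have := mulr_ge0 (sqr_ge0 (- (B u y / B u e))) (ltW Bee).
  lra.
have eE : (e <= eigenspace (gram B) a)%MS by apply/eigenspace_gramP.
have uniq (b : R) x : 0 < b -> (forall y, B x y = b * dot x y) -> dot e x = 0 -> x = 0.
  move=> b0 xB /nege; rewrite xB => h; apply: dot_eq0; apply: le_anti.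
  by rewrite dot_ge0 andbT -(pmulr_rle0 _ b0).
exists a; split => //.
  apply/eqP; rewrite eqn_leq lt0n mxrank_eq0; apply/andP; split; last first.
    by apply: contra e0 => /eqP E; rewrite E submx0 in eE.
  have <- : \rank e = 1%N by rewrite rank_rV e0.
  apply: mxrankS; apply/row_subP => i; set x := row i _.
  have /(eigenspace_gramP _ _ Bs) xB : (x <= eigenspace (gram B) a)%MS by exact: row_sub.
  have : x - (dot e x / dot e e) *: e = 0.
    apply: (uniq a) => // [y|].
      rewrite -scaleNr (symbilinD Bs) BZ (symbilinD dot_symbilin) dZ xB eB; ring.
    rewrite -scaleNr dC (symbilinD dot_symbilin) dZ dC.
    by field; rewrite gt_eqF // dot_gt0.
  by move/eqP; rewrite subr_eq0 => /eqP ->; exact: scalemx_sub.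
move=> b b0 /eigenvalueP [x /eigenspaceP xb x0].
have {}xb := (eigenspace_gramP _ _ Bs).1 xb.
apply/eqP; apply: contraR x0 => ba; apply/eqP/(uniq b) => //.
(* Eigenvectors for distinct eigenvalues are orthogonal. *)
have := eB x; rewrite BC xb dC => /eqP; rewrite -subr_eq0 -mulrBl mulf_eq0 subr_eq0.
by rewrite (negPf ba) => /eqP.
Qed.

(* Both [A] and [B] are nonpositive on the hyperplane [A b x = B a x = 0]. *)
Lemma hyperbolic_add A B L a b : symbilin A -> symbilin B ->
  (forall x, A b x = B a x) -> 0 <= A a a -> 0 <= B b b ->
  hyperbolic A L b -> hyperbolic B L a ->
  hyperbolic (fun x y => A x y + B x y) L (a + b).
Proof.
move=> As Bs AB Aaa Bbb [Abb Aneg] [Baa Bneg].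
pose M x y := A x y + B x y.
have Ms : symbilin M.
  by split=> [x y|c x y z]; rewrite /M; [rewrite As.1 Bs.1|rewrite As.2 Bs.2; ring].
have AC := As.1; have BC := Bs.1; have MC := Ms.1.
pose w := a + b; pose l x := A b x.
have lw : l w = B a a + A b b by rewrite /l AC (symbilinD As) (AC a) AB.
have lw0 : 0 < l w by rewrite lw addr_gt0.
change (hyperbolic M L w).
have hM x : l x = 0 -> M x x <= 0 /\ (M x x = 0 -> L x).
  move=> lx; have [An A0] := Aneg x lx; have [Bn B0] : B x x <= 0 /\ (B x x = 0 -> L x).
    by apply: Bneg; rewrite -AB.
  split; rewrite /M; first by lra.
  by move=> e; apply: A0; lra.
have Mww : 0 < M w w.
  rewrite /M /w -[a]scale1r -[b]scale1r (symbilin_quad As) (symbilin_quad Bs).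
  have := AB a; have := AB b; rewrite (AC b a) => h1 h2; rewrite h2 -h1 in Abb Baa *.
  lra.
split => // x Mwx.
(* Correct [x] along [w] into the hyperplane [l = 0]; since [M w x = 0], the value there is
   [M x x + c ^+ 2 * M w w]. *)
pose c := l x / l w; pose h := 1 *: x + (- c) *: w.
have lh : l h = 0.
  by rewrite /l /h AC (symbilin_lin As) (AC x) (AC w) -/(l x) -/(l w) /c; field; rewrite gt_eqF.
have [hn h0] := hM h lh.
move: hn; rewrite (symbilin_quad Ms) (MC x w) Mwx.
have p : 0 <= (- c) ^+ 2 * M w w by rewrite mulr_ge0 ?sqr_ge0 // ltW.
move=> hn; split; first by lra.
move=> Mxx; have : (- c) ^+ 2 * M w w = 0 by lra.
move/eqP; rewrite mulf_eq0 (gt_eqF Mww) orbF sqrf_eq0 oppr_eq0 => /eqP c0.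
have hx : h = x by rewrite /h c0 oppr0 scale0r addr0 scale1r.
by move: h0; rewrite hx; apply.
Qed.
End SymmetricForms.

(** * Cones and Minkowski's theorem *)

Section AbstractLinearSets.
Variables (R : realType) (V : lmodType R).
Implicit Types (x y : V) (L : set V).

Definition linear_set L := L 0 /\ forall (a : R) x y, L x -> L y -> L (a *: x + y).

Lemma linear_setZ L : linear_set L -> forall a x, L x -> L (a *: x).
Proof. by move=> [L0 Ll] a x Lx; rewrite -[_ *: _]addr0; exact: Ll. Qed.

Lemma linear_setD L : linear_set L -> forall x y, L x -> L y -> L (x + y).
Proof. by move=> [L0 Ll] x y Lx Ly; rewrite -[x]scale1r; exact: Ll. Qed.
End AbstractLinearSets.

(** * Linear subspaces of row vectors and orthogonal projection *)

Section LinearSets.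
Variables (R : realType) (n : nat).
Local Notation V := 'rV[R]_n.
Implicit Types (x y z w : V) (L : set V).

(** Vectors of [L] are added one by one to a row space; the codimension [n - \rank M] bounds the
    number of additions. *)
Lemma linear_set_row_space L : linear_set L ->
  exists M : 'M[R]_n, forall x, L x <-> (x <= M)%MS.
Proof.
move=> Ll.
suff H k : forall M : 'M[R]_n, (n - \rank M <= k)%N ->
    (forall x, (x <= M)%MS -> L x) -> exists M : 'M[R]_n, forall x, L x <-> (x <= M)%MS.
  by apply: (H n 0) => [|x]; rewrite ?leq_subr // submx0 => /eqP ->; exact: Ll.1.
elim: k => [|k IH] M rM ML.
  exists M => x; split => [_|]; last exact: ML.
  apply: submx_full; rewrite /row_full eqn_leq rank_leq_col /=.
  by rewrite leqn0 subn_eq0 in rM.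
have [LM|/existsNP[x /not_implyP[Lx xM]]] := pselect (forall x, L x -> (x <= M)%MS).
  by exists M => x; split; [exact: LM|exact: ML].
apply: (IH (M + x)%MS).
  have lt : (\rank M < \rank (M + x)%MS)%N.
    by apply: rank_ltmx; rewrite ltmxE addsmxSl addsmx_sub submx_refl; apply/negP.
  by rewrite -ltnS (leq_trans _ rM) // ltn_sub2l // (leq_trans lt) // rank_leq_col.
move=> y /sub_addsmxP[[u w] /= ->]; rewrite addrC (mx11_scalar w) mul_scalar_mx.
by apply: Ll.2 => //; apply: ML; exact: submxMl.
Qed.

Lemma dot_mulmx x y : dot x y = (x *m y^T) 0 0.
Proof. by rewrite mxE; apply: eq_bigr => i _; rewrite mxE. Qed.

(** The row space of [M] and its orthogonal complement [kermx M^T] meet trivially and have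
    complementary ranks, hence span everything. *)
Lemma orthogonal_projection L x : linear_set L ->
  exists2 l, L l & forall w, L w -> dot (x - l) w = 0.
Proof.
move=> Ll; have [M LM] := linear_set_row_space Ll.
have cap : (M :&: kermx M^T = 0)%MS.
  apply/eqP/rowV0P => z; rewrite sub_capmx => /andP[/submxP[u zu] /sub_kermxP zM].
  apply: dot_eq0; rewrite dot_mulmx [in X in _ *m X]zu trmx_mul mulmxA zM.
  by rewrite mul0mx mxE.
have : (x <= M + kermx M^T)%MS.
  apply: submx_full; rewrite /row_full.
  have := mxrank_sum_cap M (kermx M^T).
  by rewrite cap mxrank0 addn0 => ->; rewrite mxrank_ker mxrank_tr subnKC // rank_leq_row.
move=> /sub_addsmxP[[u w] /= ->]; exists (u *m M); first by apply/LM/submxMl.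
move=> z /LM/submxP[t ->]; rewrite addrC addKr dot_mulmx trmx_mul mulmxA.
by rewrite -(mulmxA w) mulmx_ker mulmx0 mul0mx mxE.
Qed.

(** A dimension function, known only through its strict monotonicity: the measure for the induction
    on faces. *)
Lemma linear_set_rank : exists rk : set V -> nat, forall A B,
  linear_set A -> linear_set B -> A `<=` B -> ~ (B `<=` A) -> (rk A < rk B)%N.
Proof.
have /boolp.choice[F FP] (A : set V) :
    exists M : 'M[R]_n, linear_set A -> forall x, A x <-> (x <= M)%MS.
  have [Al|nA] := pselect (linear_set A); last by exists 0.
  by have [M hM] := linear_set_row_space Al; exists M.
exists (fun A => \rank (F A)) => A B Al Bl AB BA.
apply: rank_ltmx; rewrite ltmxE; apply/andP; split.
  by apply/row_subP => i; apply/(FP B Bl)/AB/(FP A Al); exact: row_sub.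
apply/negP => FBA; apply: BA => x /(FP B Bl) xB; apply/(FP A Al).
exact: submx_trans FBA.
Qed.
End LinearSets.

(** * Minkowski's theorem for an abstract cone *)

Section ClosedCone.
Variables (R : realType) (V : lmodType R) (C : set V) (rk : set V -> nat).
Implicit Types (x y z w u v : V) (a b c e s t : R).
Hypothesis closure_cone0 : C 0.
Hypothesis closure_coneD : forall x y, C x -> C y -> C (x + y).
Hypothesis closure_coneZ : forall a x, 0 <= a -> C x -> C (a *: x).
Hypothesis line_max : forall v x, C v -> ~ C (- x) ->
  exists t, [/\ 0 <= t, C (v - t *: x) & forall s, C (v - s *: x) -> s <= t].
Hypothesis rk_lt : forall A B, linear_set A -> linear_set B ->
  A `<=` B -> ~ (B `<=` A) -> (rk A < rk B)%N.

Definition lineal : set V := [set x | C x /\ C (- x)].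
Definition pointed_part : set V := [set x | C x /\ ~ lineal x].
Local Notation L := lineal.
Local Notation P := pointed_part.

Definition extreme v := forall x y, C x -> C y -> x + y = v ->
  exists2 c : R, 0 <= c & L (x - c *: v).

Lemma linear_lineal : linear_set L.
Proof.
split; first by split; rewrite ?oppr0; exact: closure_cone0.
have H a x : L x -> C (a *: x).
  move=> [Cx CNx]; have [a0|a0] := leP 0 a; first exact: closure_coneZ.
  by rewrite -[a]opprK scaleNr -scalerN; apply: closure_coneZ => //; lra.
move=> a x y Lx [Cy CNy]; split; first exact: (closure_coneD (H a x Lx) Cy).
by rewrite opprD -scaleNr; exact: (closure_coneD (H _ x Lx) CNy).
Qed.

Lemma pointed_partD x y : P x -> C y -> P (x + y).
Proof.
move=> [Cx Lx] Cy; split; first exact: closure_coneD.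
move=> [_ CN]; apply: Lx; split; first exact: Cx.
by have := closure_coneD CN Cy; rewrite opprD addrNK; apply.
Qed.

Lemma pointed_partZ a x : 0 < a -> P x -> P (a *: x).
Proof.
move=> a0 [Cx Lx]; split; first exact: (closure_coneZ (ltW a0) Cx).
move=> /(linear_setZ linear_lineal a^-1).
rewrite scalerA mulVf ?gt_eqF // scale1r.
exact: Lx.
Qed.

(* The directions of the smallest face of [closure K] containing [v]. *)
Definition face_directions v : set V :=
  [set z | exists2 c, 0 < c & C (v + c *: z) /\ C (v - c *: z)].

Lemma linear_face_directions v : C v -> linear_set (face_directions v).
Proof.
move=> Cv; split; first by exists 1 => //; rewrite scaler0 addr0 subr0.
have key a z : face_directions v z -> face_directions v (a *: z).
  move=> [c c0 [Cp Cm]].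
  have [->|a0] := eqVneq a 0.
    by rewrite scale0r; exists 1 => //; rewrite scaler0 addr0 subr0.
  have na : 0 < `|a| by rewrite normr_gt0.
  exists (c / `|a|); first exact: divr_gt0.
  rewrite scalerA; case: (ltgtP 0 a) a0 => // asgn _.
    by rewrite gtr0_norm // divfK ?gt_eqF.
  by rewrite ltr0_norm // invrN mulrN mulNr divfK ?lt_eqF // scaleNr opprK.
move=> a x y /(key a); move: (a *: x) => {}x [c c0 [xp xm]] [d d0 [yp ym]].
have cd : 0 < c + d by exact: addr_gt0.
(* The convex weights [d / (c + d)] and [c / (c + d)] give [p] and [q] the same coefficient. *)
have mid p q : C (v + c *: p) -> C (v + d *: q) ->
    C (v + (c * d / (c + d)) *: (p + q)).
  move=> Cp Cq.
  have -> : v + (c * d / (c + d)) *: (p + q) =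
      (d / (c + d)) *: (v + c *: p) + (c / (c + d)) *: (v + d *: q).
    rewrite !scalerDr !scalerA addrACA -scalerDl.
    have -> : d / (c + d) + c / (c + d) = 1 by field; rewrite gt_eqF.
    have -> : d / (c + d) * c = c * d / (c + d) by rewrite mulrAC (mulrC d).
    by rewrite scale1r (mulrAC c).
  by apply: closure_coneD; apply: closure_coneZ => //; rewrite divr_ge0 // ltW.
exists (c * d / (c + d)); first by rewrite divr_gt0 // mulr_gt0.
split; first exact: mid.
by rewrite -scalerN opprD; apply: mid; rewrite scalerN.
Qed.

(* Minkowski's theorem modulo the lineality space.  If [v] is not extreme,
   choose a direction [x] in its face, not proportional to [v]; moving from [v]
   along [-x], and from [x] along [-v], as far as possible yields two vectors
   on smaller faces, of which [v] is a positive combination. *)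
Lemma pointed_part_extreme_ind (Q : V -> Prop) :
  (forall v, P v -> extreme v -> Q v) ->
  (forall a v, 0 < a -> P v -> Q v -> Q (a *: v)) ->
  (forall x y, P x -> P y -> Q x -> Q y -> Q (x + y)) ->
  forall v, P v -> Q v.
Proof.
move=> QS QZ QD; have LL := linear_lineal.
(* Induction on the dimension of the smallest face containing [v]. *)
suff H k v : (rk (face_directions v) < k)%N -> P v -> Q v.
  by move=> v Pv; exact: H (ltnSn _) Pv.
elim: k v => // k IH v rv Pv.
have [Cv NLv] := Pv.
have smaller w z : P w -> face_directions w `<=` face_directions v ->
    face_directions v z -> ~ face_directions w z -> Q w.
  move=> Pw wv vz wz; apply: (IH _ _ Pw); rewrite ltnS in rv; apply: leq_trans rv.
  apply: rk_lt => //; [exact: (linear_face_directions Pw.1)|exact: linear_face_directions|].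
  by move=> /(_ _ vz).
have [ext|] := pselect (extreme v); first exact: QS.
move=> /existsNP[x /existsNP[y /not_implyP[Cx /not_implyP[Cy /not_implyP[xy nx]]]]].
have NLx : ~ L x by move=> Lx; apply: nx; exists 0; rewrite ?scale0r ?subr0.
have CNx : ~ C (- x) by move=> h; apply: NLx.
have CNv : ~ C (- v) by move=> h; apply: NLv.
have vx : face_directions v x.
  exists 1 => //; rewrite scale1r; split; first exact: closure_coneD.
  by rewrite -xy addrAC subrr add0r.
have vv : face_directions v v.
  exists 1 => //; rewrite scale1r; split; first exact: closure_coneD.
  by rewrite subrr; exact: closure_cone0.
have [t [t0 Ct tmax]] := line_max Cv CNx.
have [s [s0 Cs smax]] := line_max Cx CNv.
have tgt0 : 0 < t.
  apply: lt_le_trans (tmax 1 _) => //.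
  by rewrite scale1r -xy addrAC subrr add0r.
set v' := v - t *: x in Ct; set x' := x - s *: v in Cs.
have Pv' : P v'.
  split=> // Lv'; apply: nx; exists t^-1; first by rewrite invr_ge0.
  have -> : x - t^-1 *: v = (- t^-1) *: v'.
    by rewrite /v' scaleNr scalerBr scalerA mulVf ?gt_eqF // scale1r opprB.
  exact: linear_setZ.
have Px' : P x' by split=> // Lx'; apply: nx; exists s.
have Qv' : Q v'.
  apply: (smaller _ x) => //.
    move=> z [c c0 [zp zm]]; exists c => //.
    have -> : v = v' + t *: x by rewrite /v' subrK.
    by split; rewrite addrAC; apply: closure_coneD => //; exact: closure_coneZ.
  (* By maximality of [t] one cannot continue from [v'] along [- x]: its face has lost the direction
     [x]. *)
  move=> [c c0 [_]]; rewrite /v' -addrA -opprD -scalerDl => /tmax; lra.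
have Qx' : Q x'.
  apply: (smaller _ v) => //.
    move=> z [c c0 [zp zm]]; exists c => //.
    have -> : v = x' + (y + s *: v) by rewrite /x' addrACA addNr addr0.
    have Cys : C (y + s *: v) by apply: closure_coneD => //; exact: closure_coneZ.
    by split; rewrite addrAC; exact: closure_coneD.
  move=> [c c0 [_]]; rewrite /x' -addrA -opprD -scalerDl => /smax; lra.
have E : (1 - t * s) *: v = v' + t *: x'.
  by rewrite /v' /x' scalerBr scalerA addrA subrK scalerBl scale1r.
have Ptx : P (t *: x') by exact: pointed_partZ.
have PE : P (v' + t *: x') by exact: pointed_partD Pv' Ptx.1.
(* Otherwise [v' + t *: x'] would be a nonpositive multiple of [v], so that its negative would also
   lie in the cone. *)
have ts : 0 < 1 - t * s.
  rewrite ltNge; apply/negP => ts; apply: PE.2; split; first exact: PE.1.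
  by rewrite -E -scaleNr; apply: closure_coneZ => //; lra.
have -> : v = (1 - t * s)^-1 *: (v' + t *: x').
  by rewrite -E scalerA mulVf ?gt_eqF // scale1r.
apply: (QZ) => //; first by rewrite invr_gt0.
by apply: QD => //; exact: QZ.
Qed.
End ClosedCone.

(** * Open convex cones, their closure and lineality space *)

Section OpenCone.
Variables (R : realType) (n : nat) (K : set 'rV[R]_n).
Hypothesis hK : open_convex_cone K.
Hypothesis K_proper : K <> setT.
Local Notation V := 'rV[R]_n.
Implicit Types (x y z w u v : V) (a b c e s t : R).
Local Notation L := (lineality K).
Local Notation C := (closure K).

Lemma coneZ a x : 0 < a -> K x -> K (a *: x).
Proof. by case: hK => _ _; exact. Qed.

Lemma coneD x y : K x -> K y -> K (x + y).
Proof.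
move=> Kx Ky; case: hK => _ Kc _.
have h0 : 0 <= 2^-1 :> R by lra.
have h1 : 2^-1 <= 1 :> R by lra.
have := Kc x y (Itv01 h0 h1); rewrite !inE => /(_ Kx Ky) /(@coneZ 2 _ _).
rewrite /conv /= => /(_ ltac:(lra)).
rewrite scalerDr !scalerA /unstable.onem.
have -> : 2 * 2^-1 = 1 :> R by field.
have -> : 2 * (1 - 2^-1) = 1 :> R by field.
by rewrite !scale1r.
Qed.

Lemma line_continuous u z : continuous (fun s : R => u + s *: z).
Proof.
move=> s; apply: cvgD; first exact: cvg_cst.
by apply: cvgZr_tmp; exact: cvg_id.
Qed.

Lemma cone_algebraically_open u z : K u ->
  exists2 e, 0 < e & forall s, `|s| < e -> K (u + s *: z).
Proof.
move=> Ku; case: hK => Ko _ _.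
have /nbhs_ballP[e /= e0 he] : nbhs (0 : R) ((fun s => u + s *: z) @^-1` K).
  apply: (line_continuous (u := u) (z := z) (x := 0)).
  by rewrite scale0r addr0; exact: open_nbhs_nbhs.
exists e => // s se; apply: he.
by rewrite /ball /= sub0r normrN.
Qed.

(** An open set around the origin is absorbing, so its positive multiples fill the space, against
    [K_proper]. *)
Lemma cone_not0 : ~ K 0.
Proof.
move=> K0; apply: K_proper; apply/seteqP; split=> // x _.
have [e e0 he] := cone_algebraically_open x K0.
have e2 : 0 < e / 2 by lra.
have := he (e / 2); rewrite add0r gtr0_norm // => /(_ ltac:(lra)).
move=> /(coneZ (a := (e / 2)^-1)); rewrite invr_gt0 => /(_ e2).
by rewrite scalerA mulVf ?scale1r // gt_eqF.
Qed.

Variable u0 : V.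
Hypothesis Ku0 : K u0.

(** Trades topological closure for translates along one fixed vector of [K], which makes the cone
    arguments below algebraic. *)
Lemma closureP x : C x <-> forall e, 0 < e -> K (x + e *: u0).
Proof.
split=> [Cx e e0|h].
  have Keu : K (e *: u0) by exact: coneZ.
  have cy : continuous (fun y : V => x + e *: u0 - y).
    by move=> y; apply: (cvgB (cvg_cst _) cvg_id).
  case: hK => Ko _ _.
  (* For [y] near [x] the vector [x + e *: u0 - y] is near [e *: u0], hence in [K]; some such [y]
     also lies in [K], and the two are added. *)
  have /Cx [y [Ky]] : nbhs x ((fun y : V => x + e *: u0 - y) @^-1` K).
    by apply: cy; rewrite addrAC subrr add0r; exact: open_nbhs_nbhs.
  by move=> /= /(coneD Ky); rewrite addrCA subrr addr0.
move=> B Bx.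
have /nbhs_ballP[e /= e0 he] : nbhs (0 : R) ((fun s => x + s *: u0) @^-1` B).
  apply: (line_continuous (u := x) (z := u0) (x := 0)).
  by rewrite scale0r addr0.
have e2 : 0 < e / 2 by lra.
exists (x + (e / 2) *: u0); split; first exact: h.
by apply: he; rewrite /ball /= sub0r normrN gtr0_norm //; lra.
Qed.

Lemma cone_closure x : K x -> C x.
Proof. by move=> Kx; apply/closureP => e e0; apply: coneD => //; exact: coneZ. Qed.

Lemma closure_cone0 : C 0.
Proof. by apply/closureP => e e0; rewrite add0r; exact: coneZ. Qed.

(** A little of [u0] is taken from [x], which stays in the open cone, and given to [y], which enters
    it. *)
Lemma cone_closureD x y : K x -> C y -> K (x + y).
Proof.
move=> Kx /closureP Cy; have [e e0 he] := cone_algebraically_open u0 Kx.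
have := he (- (e / 2)); rewrite normrN gtr0_norm ?divr_gt0 // => /(_ ltac:(lra)).
have e2 : 0 < e / 2 by lra.
by move=> /coneD /(_ (Cy _ e2)); rewrite scaleNr addrACA addNr addr0.
Qed.

Lemma closure_coneD x y : C x -> C y -> C (x + y).
Proof.
move=> /closureP Cx Cy; apply/closureP => e e0.
by rewrite addrAC; apply: cone_closureD => //; exact: Cx.
Qed.

Lemma closure_coneZ a x : 0 <= a -> C x -> C (a *: x).
Proof.
rewrite le_eqVlt => /orP[/eqP <- _|a0 /closureP Cx].
  by rewrite scale0r; exact: closure_cone0.
apply/closureP => e e0.
have -> : a *: x + e *: u0 = a *: (x + (e / a) *: u0).
  by rewrite scalerDr scalerA mulrCA divff ?gt_eqF // mulr1.
by apply: coneZ => //; apply: Cx; exact: divr_gt0.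
Qed.

Lemma cone_not_lineality x : K x -> ~ L x.
Proof. by move=> Kx [_ /(cone_closureD Kx)]; rewrite subrr; exact: cone_not0. Qed.

(** Dividing [v - s *: x] by a large [s] would put [- x + e *: u0] into [K], so the admissible [s]
    are bounded. The supremum is attained by [closureP], a small change of [s] being absorbed by a
    multiple of [u0]. *)
Lemma closure_line_max v x : C v -> ~ C (- x) ->
  exists t, [/\ 0 <= t, C (v - t *: x) & forall s, C (v - s *: x) -> s <= t].
Proof.
move=> Cv CNx.
pose A := [set s : R | C (v - s *: x)].
have A0 : A 0 by rewrite /A /= scale0r subr0.
have [e e0 he] : exists2 e, 0 < e & ~ K (- x + e *: u0).
  apply: contrapT => h; apply: CNx; apply/closureP => e e0.
  by apply: contrapT => hk; apply: h; exists e.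
have [d d0 hd] := cone_algebraically_open (- v) (coneZ e0 Ku0).
have ubA : ubound A (d^-1 + 1).
  move=> s /= As; rewrite leNgt; apply/negP => sd; apply: he.
  have di : 0 < d^-1 by rewrite invr_gt0.
  have s0 : 0 < s by lra.
  have si : 0 < s^-1 by rewrite invr_gt0.
  have Ks : K (e *: u0 + s^-1 *: - v).
    have sd' : `|s^-1| < d.
      rewrite (gtr0_norm si) -(invrK d) ltf_pV2; [|exact: s0|exact: di].
      by apply: lt_trans sd; rewrite ltrDl.
    exact: (hd s^-1 sd').
  have := cone_closureD Ks (closure_coneZ (ltW si) As).
  have sV : s^-1 * s = 1 by apply: mulVf; rewrite gt_eqF.
  rewrite scalerBr scalerA sV scale1r; congr K.
  by apply/rowP => i; rewrite !mxE; ring.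
have supA : has_sup A by split; [exists 0|exists (d^-1 + 1)].
exists (sup A); split; first exact: (sup_upper_bound supA).
  apply/closureP => r r0.
  have [c c0 hc] := cone_algebraically_open x (coneZ r0 Ku0).
  have [s As lts] := sup_adherent c0 supA.
  have les : s <= sup A by exact: (sup_upper_bound supA).
  have Kc : K (r *: u0 + (s - sup A) *: x).
    by apply: hc; rewrite distrC ger0_norm; lra.
  have := cone_closureD Kc As; congr K.
  by apply/rowP => i; rewrite !mxE; ring.
by move=> s As; exact: (sup_upper_bound supA).
Qed.

Local Notation P := (pointed_part C).

Lemma lineality_linear : linear_set L.
Proof. exact: (linear_lineal closure_cone0 closure_coneD closure_coneZ). Qed.

Lemma cone_pointed x : K x -> P x.
Proof. by move=> Kx; split; [exact: cone_closure|exact: cone_not_lineality]. Qed.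

(** Minkowski induction with normalized generators: an extreme vector is projected off [L] and
    scaled to unit length, and stability of [Q] under translation by [L] undoes the projection. *)
Lemma pointed_part_ind (Q : V -> Prop) :
  (forall v, extreme_vectors_mod K v -> Q v) ->
  (forall a v, 0 < a -> P v -> Q v -> Q (a *: v)) ->
  (forall x y, P x -> P y -> Q x -> Q y -> Q (x + y)) ->
  (forall v l, P v -> L l -> Q v -> Q (v + l)) ->
  forall v, P v -> Q v.
Proof.
move=> QS QZ QD QL.
have LL := lineality_linear.
have PZ := pointed_partZ closure_cone0 closure_coneD closure_coneZ.
have PD := pointed_partD closure_coneD.
have [rk rk_lt] := linear_set_rank R n.
apply: (pointed_part_extreme_ind closure_cone0 closure_coneD closure_coneZ
  closure_line_max rk_lt); [|exact: QZ|exact: QD] => v Pv ext.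
have [l Ll vl] := orthogonal_projection v LL.
have Ps : P (v - l) by apply: PD; [exact: Pv|exact: Ll.2].
have s0 : v - l != 0 by apply/eqP => e; apply: Ps.2; rewrite e; exact: LL.1.
have [a [a0 a1]] := unit_scaling s0.
have E : v = a^-1 *: (a *: (v - l)) + l.
  by rewrite scalerA mulVf ?gt_eqF // scale1r subrK.
have Pa := PZ _ _ a0 Ps; have ai : 0 < a^-1 by rewrite invr_gt0.
suff Qs : Q (a *: (v - l)) by rewrite E; exact: (QL _ _ (PZ _ _ ai Pa) Ll (QZ _ _ ai Pa Qs)).
apply: QS; split; last first.
  by move=> w Lw; rewrite (symbilinZ (@dot_symbilin R n)) (vl w Lw) mulr0.
split; first exact: a1.
split; [exact: Pa.1|exact: Pa.2|].
move=> x y Cx Cy xy.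
(* A splitting of the normalized vector is scaled back and shifted by [l] into a splitting of [v],
   to which extremality applies. *)
have Cx' := closure_coneZ (ltW ai) Cx.
have Cy' := closure_coneD (closure_coneZ (ltW ai) Cy) Ll.1.
have [|c c0 Lc] := ext _ _ Cx' Cy'; first by rewrite addrA -scalerDr xy; exact: (esym E).
exists c; first exact: c0.
have -> : x - c *: (a *: (v - l)) = a *: (a^-1 *: x - c *: v) + (c * a) *: l.
  by apply/rowP => i; rewrite !mxE; field; rewrite gt_eqF.
exact: (linear_setD LL (linear_setZ LL _ Lc) (linear_setZ LL _ Ll)).
Qed.

Definition unit_pointed : set V :=
  [set v | [/\ C v, dot v v = 1 & forall l, L l -> dot l v = 0]].

Lemma unit_pointed_part v : unit_pointed v -> P v.
Proof.
move=> [Cv v1 vL]; split=> // Lv.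
by have := vL _ Lv; rewrite v1 => /eqP; rewrite oner_eq0.
Qed.

Lemma extreme_vectors_mod_unit v : extreme_vectors_mod K v -> unit_pointed v.
Proof.
move=> [[v1 [Cv _ _]] vL]; split=> // l Ll.
by rewrite (@dot_symbilin R n).1 vL.
Qed.

Lemma closed_unit_pointed : closed unit_pointed.
Proof.
have -> : unit_pointed = C `&` ([set v | dot v v = 1] `&`
    \bigcap_(l in L) [set v | dot l v = 0]).
  by apply/seteqP; split=> v [] => [? ? ?|? [? ?]]; split => //; split.
apply: closedI; first exact: closed_closure.
apply: closedI; first exact: closed_unit_sphere.
by apply: closed_bigI => l _; exact: closed_dot0.
Qed.
End OpenCone.

(** * Directional derivatives of polynomials *)

Section DirectionalDerivatives.
Variables (R : realType) (n : nat).
Local Notation V := 'rV[R]_n.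
Implicit Types (u v w x y : V) (s t : seq V) (p q : mpoly n R) (m : multinom n).

Lemma dirderiv_lin a u v p :
  dirderiv (a *: u + v) p = a *: dirderiv u p + dirderiv v p.
Proof.
rewrite /dirderiv scaler_sumr -big_split /=; apply: eq_bigr => i _.
by rewrite !mxE scalerDl scalerA.
Qed.

Lemma dirderiv_is_linear u : linear (dirderiv u).
Proof.
move=> a p q; rewrite /dirderiv scaler_sumr -big_split /=; apply: eq_bigr => i _.
by rewrite linearP scalerDr !scalerA mulrC.
Qed.

Lemma dirderiv0 u : dirderiv u 0 = 0.
Proof.
by apply: big1 => i _; rewrite mderiv0 scaler0.
Qed.

Lemma dirderivC u v p : dirderiv u (dirderiv v p) = dirderiv v (dirderiv u p).
Proof.
have E x y : dirderiv x (dirderiv y p) =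
    \sum_(i < n) \sum_(j < n) (x 0 i * y 0 j) *: mderiv i (mderiv j p).
  apply: eq_bigr => i _; rewrite /dirderiv (linear_sum (mderiv i)) scaler_sumr.
  by apply: eq_bigr => j _; rewrite /= mderivZ scalerA.
rewrite !E exchange_big /=; apply: eq_bigr => i _; apply: eq_bigr => j _.
by rewrite mulrC mderiv_comm.
Qed.

Lemma dirderivs_dirderiv u s p :
  dirderivs s (dirderiv u p) = dirderiv u (dirderivs s p).
Proof. by elim: s => //= v s ->; exact: dirderivC. Qed.

Lemma dirderivs_is_linear s : linear (dirderivs s).
Proof. by elim: s => // v s IH a p q /=; rewrite IH dirderiv_is_linear. Qed.

Lemma dirderivs0 s : dirderivs s (0 : mpoly n R) = 0.
Proof. by elim: s => //= v s ->; exact: dirderiv0. Qed.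

Lemma dirderivs_catC s t p :
  dirderivs s (dirderivs t p) = dirderivs t (dirderivs s p).
Proof. by elim: s => //= v s ->; rewrite dirderivs_dirderiv. Qed.

Lemma dirval_perm s t p : perm_eq s t -> dirval s p = dirval t p.
Proof.
apply: (@catCA_perm_subst V R (fun t => dirval t p)) => s1 s2 s3.
have cat t1 t2 : dirderivs (t1 ++ t2) p = dirderivs t1 (dirderivs t2 p).
  exact: foldr_cat.
by rewrite /dirval !cat dirderivs_catC.
Qed.

Lemma dirval_consl a x y s p :
  dirval (a *: x + y :: s) p = a * dirval (x :: s) p + dirval (y :: s) p.
Proof. by rewrite /dirval /= dirderiv_lin mcoeffD mcoeffZ. Qed.

Lemma dirval_poly s a p q : dirval s (a *: p + q) = a * dirval s p + dirval s q.
Proof. by rewrite /dirval dirderivs_is_linear mcoeffD mcoeffZ. Qed.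

Lemma dirval_null w s p : dirderiv w p = 0 -> dirval (w :: s) p = 0.
Proof.
by move=> wp; rewrite /dirval /= -dirderivs_dirderiv wp dirderivs0 mcoeff0.
Qed.

Lemma dirform_symbilin s p : symbilin (dirform s p).
Proof.
split=> [x y|a x y z]; rewrite /dirform; last exact: dirval_consl.
by rewrite /dirval /= dirderivC.
Qed.

Lemma mcoeff_dirderiv m u q : mcoeff m (dirderiv u q) =
  \sum_(i < n) u 0 i * ((m i).+1%:R * mcoeff (mnm_add m (mnm1 i)) q).
Proof.
rewrite /dirderiv raddf_sum /=; apply: eq_bigr => i _.
by rewrite mcoeffZ mcoeff_deriv mulr_natl.
Qed.

Lemma continuous_mcoeff_dirderivs (T : topologicalType) (h : seq (T -> V)) p m :
  (forall g, List.In g h -> forall i, continuous (fun r => g r 0 i)) ->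
  continuous (fun r => mcoeff m (dirderivs [seq g r | g <- h] p)).
Proof.
elim: h m => [|g h IH] m hc /=; first exact: cst_continuous.
under eq_fun do rewrite mcoeff_dirderiv.
apply: continuous_sum => i r; apply: cvgM; first by apply: hc; left.
apply: cvgM; first exact: cvg_cst.
by apply: IH => g' hg'; apply: hc; right.
Qed.

Lemma continuous_dirval (T : topologicalType) (h : seq (T -> V)) p :
  (forall g, List.In g h -> forall i, continuous (fun r => g r 0 i)) ->
  continuous (fun r => dirval [seq g r | g <- h] p).
Proof. exact: continuous_mcoeff_dirderivs. Qed.

(** Each derivative is a sum of [n] terms with multipliers at most [mdeg m + size s]. A step of the
    recursion raises the degree of [m] by one and shortens [s] by one, so this bound stays the same
    throughout. *)
Lemma mcoeff_dirderivs_bound s p e m :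
  (forall m, `|mcoeff m p| <= e) ->
  (forall v, v \in s -> forall i, `|v 0 i| <= 1) ->
  `|mcoeff m (dirderivs s p)| <=
    ((n * (mdeg m + size s).+1) ^ size s)%:R * e.
Proof.
move=> pe; elim: s m => [|v s IH] m sle /=; first by rewrite mul1r.
rewrite mcoeff_dirderiv; apply: le_trans (ler_norm_sum _ _ _) _.
set N := (mdeg m + (size s).+1).+1.
have E : ((n * N) ^ (size s).+1)%:R * e =
    \sum_(i < n) N%:R * (((n * N) ^ size s)%:R * e).
  by rewrite sumr_const card_ord -[RHS]mulr_natl expnS !natrM !mulrA.
rewrite E; apply: ler_sum => i _; rewrite normrM -[leRHS]mul1r.
apply: ler_pM => //; first by apply: sle; rewrite inE eqxx.
rewrite normrM normr_nat; apply: ler_pM => //.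
  rewrite ler_nat ltnS (leq_trans _ (leq_addr _ _)) //.
  by rewrite mdegE (bigD1 i) //= leq_addr.
apply: le_trans (IH _ _) _; first by move=> w ws; apply: sle; rewrite inE ws orbT.
by rewrite mdegD mdeg1 addn1 addSnnS.
Qed.

Lemma dirval_bound s p e :
  (forall m, `|mcoeff m p| <= e) ->
  (forall v, v \in s -> forall i, `|v 0 i| <= 1) ->
  `|dirval s p| <= ((n * (size s).+1) ^ size s)%:R * e.
Proof.
move=> pe sle; have := mcoeff_dirderivs_bound (@mnm0 n) pe sle.
by rewrite mdeg0 add0n.
Qed.

Definition linear_form y : mpoly n R := \sum_(i < n) y 0 i *: mpolyX R (mnm1 i).

Lemma dirderiv_linear_form u y : dirderiv u (linear_form y) = (dot y u)%:A.
Proof.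
rewrite /dirderiv /linear_form /dot scaler_suml; apply: eq_bigr => i _.
rewrite (linear_sum (mderiv i)) /= (bigD1 i) //= big1 ?addr0 => [|j ji].
  rewrite mderivZ mderivX mnmE eqxx scale1r.
  have -> : mnm_sub (mnm1 i) (mnm1 i) = @mnm0 n.
    by apply/mnmP => k; rewrite !mnmE subnn.
  by rewrite mpolyX0 scalerA mulrC.
by rewrite mderivZ mderivX mnmE (negPf ji) scale0r scaler0.
Qed.

Lemma dirderivM u p q : dirderiv u (p * q) = dirderiv u p * q + p * dirderiv u q.
Proof.
rewrite /dirderiv mulr_suml mulr_sumr -big_split /=; apply: eq_bigr => i _.
by rewrite mderivM scalerDr scalerAl scalerAr.
Qed.

Lemma dirderiv_linear_formX u y k :
  dirderiv u (linear_form y ^+ k.+1) = (k.+1%:R * dot y u) *: linear_form y ^+ k.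
Proof.
elim: k => [|k IH]; first by rewrite expr1 mul1r expr0 dirderiv_linear_form.
rewrite exprS dirderivM IH dirderiv_linear_form -scalerAl mul1r -scalerAr -exprS.
by rewrite -scalerDl; congr (_ *: _); rewrite -(natr1 k.+1); ring.
Qed.

Lemma dirval_linear_formX s y :
  dirval s (linear_form y ^+ size s) = (size s)`!%:R * \prod_(u <- s) dot y u.
Proof.
rewrite /dirval; elim: s => [|u s IH] /=.
  by rewrite expr0 big_nil mulr1 mcoeff1 eqxx.
rewrite -dirderivs_dirderiv dirderiv_linear_formX.
have := dirderivs_is_linear s ((size s).+1%:R * dot y u) (linear_form y ^+ size s) 0.
rewrite dirderivs0 !addr0 => ->.
by rewrite mcoeffZ IH big_cons factS natrM; ring.
Qed.

Lemma linear_formX_Hspace (K : set V) y d :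
  (forall w, lineality K w -> dot y w = 0) -> (0 < d)%N ->
  Hspace d K (linear_form y ^+ d).
Proof.
move=> yL d0; split.
  have h1 : linear_form y \is ishomog1 1 (@mdeg n).
    by apply: rpred_sum => i _; apply: rpredZ; rewrite dhomogX; exact/eqP/mdeg1.
  by have := dhomogMn d h1; rewrite mul1n.
by move=> w /yL yw; rewrite -(prednK d0) dirderiv_linear_formX yw mulr0 scale0r.
Qed.

Lemma mpoly_bounded p : exists2 c, 0 < c & forall m, `|mcoeff m p| <= c.
Proof.
exists (1 + \sum_(m <- msupp p) `|mcoeff m p|).
  by rewrite ltr_pwDl // sumr_ge0.
move=> m; have [ms|ms] := boolP (m \in msupp p).
  rewrite (big_rem m) //= addrCA lerDl addr_ge0 // sumr_ge0 //.
have -> : mcoeff m p = 0 by apply/eqP; rewrite mcoeff_eq0.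
by rewrite normr0 addr_ge0 // sumr_ge0.
Qed.

Lemma Hspace_lin (K : set V) d a p q :
  Hspace d K p -> Hspace d K q -> Hspace d K (a *: p + q).
Proof.
move=> [ph pL] [qh qL]; split; first by apply: rpredD => //; exact: rpredZ.
by move=> w Lw; rewrite dirderiv_is_linear pL // qL // scaler0 addr0.
Qed.

(* A point of [L^perp] off finitely many hyperplanes, built one hyperplane at
   a time by moving along the normal vector. *)
Lemma orthogonal_generic (L : set V) s :
  (forall z, z \in s -> z != 0 /\ forall w, L w -> dot z w = 0) ->
  exists2 y, (forall w, L w -> dot y w = 0) & forall z, z \in s -> dot y z != 0.
Proof.
have dZ := symbilinZ (@dot_symbilin R n); have dD := symbilinD (@dot_symbilin R n).
elim: s => [_|x s IH sL].
  by exists 0 => [w _|z]; [exact: (symbilin0l (@dot_symbilin R n))|rewrite in_nil].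
have [|y yL ys] := IH; first by move=> z zs; apply: sL; rewrite inE zs orbT.
have [x0 xL] := sL x (mem_head _ _).
pose r := [seq `|- dot y z / dot x z| | z <- x :: s].
(* Larger than every value of [t] at which [dot (t *: x + y) z] could vanish for a [z] not
   orthogonal to [x]. *)
pose t := 1 + \sum_(b <- r) b.
have tr z : z \in x :: s -> - dot y z / dot x z != t.
  move=> zs; apply/eqP => e.
  have : `|- dot y z / dot x z| <= \sum_(b <- r) b.
    rewrite big_map (big_rem z) //= lerDl sumr_ge0 //.
  by move=> /(le_trans (ler_norm _)); rewrite e /t; lra.
exists (t *: x + y) => [w Lw|z zs]; first by rewrite dD dZ xL // yL // mulr0 addr0.
rewrite dD dZ; have [xz|xz] := eqVneq (dot x z) 0.
  (* Being orthogonal to the nonzero [x], the vector [z] comes from the tail, where [y] already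
     works. *)
  rewrite xz mulr0 add0r; move: zs; rewrite inE => /orP[/eqP zx|]; last exact: ys.
  by move: x0; rewrite -zx; move/eqP: xz; rewrite zx => /eqP/dot_eq0 ->; rewrite eqxx.
apply: contra (tr z zs) => /eqP e; apply/eqP.
have -> : - dot y z = t * dot x z by lra.
by rewrite mulfK.
Qed.
End DirectionalDerivatives.

(** * From extreme rays to the whole cone *)

(** Entries are upgraded from [S] to [P] one at a time; permutation invariance brings the current
    entry to the front. *)
Lemma seq_pred_ind (T : eqType) (S P : T -> Prop) (Q : seq T -> Prop) (N : nat) :
  (forall x, S x -> P x) ->
  (forall s t, perm_eq s t -> Q s -> Q t) ->
  (forall s, size s = N -> (forall x, x \in s -> S x) -> Q s) ->
  (forall r, (size r).+1 = N -> (forall x, x \in r -> P x) ->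
     (forall x, S x -> Q (x :: r)) -> forall x, P x -> Q (x :: r)) ->
  forall s, size s = N -> (forall x, x \in s -> P x) -> Q s.
Proof.
move=> SP Qperm QS step s sN sP.
suff H : forall s1 s2, size (s1 ++ s2) = N -> (forall x, x \in s1 -> P x) ->
    (forall x, x \in s2 -> S x) -> Q (s1 ++ s2).
  by rewrite -[s]cats0; apply: H => //; rewrite cats0.
elim=> [|x s1 IH] s2 sz s1P s2S; first exact: QS.
apply: step => [|y||].
- by rewrite -sz.
- rewrite mem_cat => /orP[ys|/s2S/SP //].
  by apply: s1P; rewrite inE ys orbT.
- move=> y Sy; apply: (Qperm (s1 ++ y :: s2)).
    by rewrite -cat_rcons perm_sym -cat_cons perm_cat2r perm_sym perm_rcons.
  apply: IH => [|z zs|z]; first by rewrite -sz /= !size_cat /= addnS.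
    by apply: s1P; rewrite inE zs orbT.
  by rewrite inE => /orP[/eqP ->//|/s2S].
- by apply: s1P; rewrite inE eqxx.
Qed.

Lemma continuous_entry (T : topologicalType) m n (i : 'I_m) (j : 'I_n) :
  continuous (fun M : 'M[T]_(m, n) => M i j).
Proof.
move=> M s Ms.
(* A box that constrains only the entry [(i, j)]. *)
exists (fun i' j' => [set x | i' = i -> j' = j -> s x]).
  move=> i' j'; have [[-> ->]|h] := pselect (i' = i /\ j' = j).
    by apply: filterS Ms => x sx.
  by apply: filterS filterT => x _ ei ej; case: h.
by move=> N hN; exact: hN.
Qed.

Section UniformPositivity.
Variables (R : realType) (T : ptopologicalType) (N : nat).

(** Tuples are encoded as row vectors, so that the product of the compact sets [A i] is compact and
    [F] attains its minimum on it; if the product is empty, any [e] works. *)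
Lemma compact_uniform_positive (A : 'I_N -> set T) (F : 'rV[T]_N -> R) :
  (forall i, compact (A i)) -> continuous F ->
  (forall M : 'rV[T]_N, (forall i, A i (M ord0 i)) -> 0 < F M) ->
  exists2 e : R, 0 < e & forall M : 'rV[T]_N, (forall i, A i (M ord0 i)) -> e <= F M.
Proof.
move=> Ac Fc Fpos.
pose B := [set M : 'rV[T]_N | forall i, A i (M ord0 i)].
have Bc : compact B by exact: rV_compact.
have [B0|nB] := pselect (B !=set0); last first.
  by exists 1 => // M BM; case: nB; exists M.
have [c cB cmin] := compact_EVT_min B0 Bc (continuous_subspaceT Fc).
exists (F c) => [|M BM]; first by apply: Fpos; move: cB; rewrite inE.
by apply: cmin; rewrite inE.
Qed.
End UniformPositivity.

(** * Hyperbolicity and the strict reverse Cauchy-Schwarz inequality *)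

Section HyperbolicForms.
Variables (R : realType) (n : nat).
Local Notation V := 'rV[R]_n.
Implicit Types (B : V -> V -> R) (x y u : V) (L : set V).

(** The eigenvalue and kernel conditions, through which the argument passes, do not involve the
    reference vector. *)
Lemma hyperbolic_change B L u v : symbilin B ->
  (forall x y, L x -> B x y = 0) -> hyperbolic B L u -> 0 < B v v ->
  hyperbolic B L v.
Proof.
move=> Bs LB Bu; have [B1 BL] := hyperbolic_one_positive_eigenvalue Bs LB Bu.
exact: one_positive_eigenvalue_hyperbolic.
Qed.

Lemma hyperbolic_scale B L u c : 0 < c -> hyperbolic B L u ->
  hyperbolic (fun x y => c * B x y) L u.
Proof.
move=> c0 [Buu neg]; split; first exact: mulr_gt0.
move=> x /eqP; rewrite mulf_eq0 gt_eqF //= => /eqP /neg [le0 eq0].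
split; first by rewrite pmulr_rle0.
by move=> /eqP; rewrite mulf_eq0 gt_eqF //= => /eqP.
Qed.

(** Strict, because the [B]-projection [z] of [x] off [u] has dot product 1 with [x] and so lies
    outside [L], to which [x] is orthogonal. *)
Lemma hyperbolic_rcs_lt B L u x : symbilin B -> hyperbolic B L u ->
  dot x x = 1 -> dot u x = 0 -> (forall w, L w -> dot w x = 0) ->
  B x x * B u u < B u x ^+ 2.
Proof.
move=> Bs [Buu neg] x1 ux xL; have BC := Bs.1.
pose z := 1 *: x + - (B u x / B u u) *: u.
have [|le0 eq0] := neg z.
  by rewrite /z BC (symbilin_lin Bs) (BC x); field; rewrite gt_eqF.
have Bz : B z z = B x x - B u x ^+ 2 / B u u.
  by rewrite /z (symbilin_quad Bs) (BC x u); field; rewrite gt_eqF.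
have nz : B z z != 0.
  apply/eqP => /eq0 /xL; rewrite /z (symbilin_lin (@dot_symbilin R n)) x1 ux => /eqP.
  by rewrite mulr0 addr0 mulr1 oner_eq0.
have : B z z < 0 by rewrite lt_neqAle nz le0.
by rewrite Bz subr_lt0 ltr_pdivlMr.
Qed.

(** A converse using unit test vectors only: [y] is split into a part in [L], a multiple of [u], and
    a remainder [z] to which the inequality applies after normalization. *)
Lemma hyperbolic_of_rcs_lt B L u : symbilin B -> linear_set L ->
  (forall x y, L x -> B x y = 0) -> dot u u = 1 -> (forall w, L w -> dot w u = 0) ->
  0 < B u u ->
  (forall x, dot x x = 1 -> dot u x = 0 -> (forall w, L w -> dot w x = 0) ->
     B x x * B u u < B u x ^+ 2) ->
  hyperbolic B L u.
Proof.
move=> Bs LL LB u1 uL Buu rcs; split => // y Buy.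
have BC := Bs.1; have ds := @dot_symbilin R n; have dC := ds.1.
have [l Ll yl] := orthogonal_projection y LL.
pose c := dot u (y - l); pose z := 1 *: (y - l) + (- c) *: u.
have yE : y = l + (1 *: z + c *: u).
  by apply/rowP => i; rewrite !mxE; ring.
have zu : dot u z = 0.
  by rewrite /z dC (symbilin_lin ds) u1 (dC (y - l)) -/c; ring.
have zL w : L w -> dot w z = 0.
  move=> Lw; rewrite /z dC (symbilin_lin ds) yl // (dC u) uL //; ring.
have BuyE : B u y = B u z + c * B u u.
  by rewrite yE BC (symbilinD Bs) LB // (symbilin_lin Bs) (BC z); ring.
have ByyE : B y y = B z z + 2 * c * B u z + c ^+ 2 * B u u.
  rewrite yE (symbilinD Bs) LB // add0r BC (symbilinD Bs) LB // add0r.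
  by rewrite (symbilin_quad Bs) (BC z u); ring.
have [z0|z0] := eqVneq z 0.
  have c0 : c = 0.
    move: Buy; rewrite BuyE z0 BC (symbilin0l Bs) add0r => /eqP.
    by rewrite mulf_eq0 (gt_eqF Buu) orbF => /eqP.
  rewrite ByyE z0 (symbilin0l Bs) BC (symbilin0l Bs) c0; split; first lra.
  by move=> _; rewrite yE z0 c0 scaler0 scale0r !addr0.
have [a [a0 a1]] := unit_scaling z0.
have := rcs _ a1; rewrite (dC u) (symbilinZ ds) dC zu mulr0 => /(_ erefl).
have azL w : L w -> dot w (a *: z) = 0.
  by move=> Lw; rewrite dC (symbilinZ ds) dC zL // mulr0.
move=> /(_ azL); rewrite (BC u) !(symbilinZ Bs) (BC z (a *: z)) (symbilinZ Bs) (BC z u).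
have -> : a * (a * B z z) * B u u = a ^+ 2 * (B z z * B u u) by ring.
rewrite exprMn ltr_pM2l ?exprn_gt0 // => lt.
(* This is [B u y = 0]; it makes [B y y] equal to [B z z - c ^+ 2 * B u u]. *)
have Bcu : B u z = - (c * B u u) by lra.
have : B y y < 0.
  rewrite ByyE Bcu -(pmulr_llt0 _ Buu); move: lt; rewrite Bcu -subr_lt0; congr (_ < _).
  ring.
by move=> Byy; split; [exact: ltW|move=> e; move: Byy; rewrite e ltxx].
Qed.
End HyperbolicForms.

Section Lorentzian.
Variables (R : realType) (n k : nat) (K : set 'rV[R]_n).
Hypothesis hK : open_convex_cone K.
Hypothesis K_proper : K <> setT.
Variable u0 : 'rV[R]_n.
Hypothesis Ku0 : K u0.
Local Notation V := 'rV[R]_n.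
Local Notation L := (lineality K).
Local Notation C := (closure K).
Local Notation P := (pointed_part (closure K)).
Local Notation S := (extreme_vectors_mod K).
Local Notation U := (unit_pointed K).
Local Notation d := k.+2.
Implicit Types (A : set V) (f g p q : mpoly n R) (u v w x y : V) (s r : seq V).

(** The set of directions is a parameter because both conditions travel between the extreme vectors,
    the pointed part and its compact section. *)
Definition PC A g :=
  forall s, size s = d -> (forall v, v \in s -> A v) -> 0 < dirval s g.

Definition HC A g :=
  forall s u, size s = k -> (forall v, v \in s -> A v) -> A u ->
    hyperbolic (dirform s g) L u.

Lemma PC_cons A g s u v : PC A g -> size s = k -> (forall v, v \in s -> A v) ->
  A u -> A v -> 0 < dirform s g u v.
Proof.
move=> pc sk sA Au Av; apply: pc => [|w]; first by rewrite /= sk.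
by rewrite !inE => /orP[/eqP->|/orP[/eqP->|/sA]].
Qed.

Lemma dirform_lineality g s x y : Hspace d K g -> L x -> dirform s g x y = 0.
Proof. by move=> [_ gL] Lx; apply: dirval_null; exact: gL. Qed.

Lemma PC_HC_extend g : Hspace d K g -> PC S g -> HC S g -> PC P g /\ HC P g.
Proof.
move=> gH pcS hcS; have gL := gH.2.
have SP v : S v -> P v by move=> Sv; exact: (unit_pointed_part (extreme_vectors_mod_unit Sv)).
have null l r : L l -> dirval (l :: r) g = 0 by move=> Ll; exact: (dirval_null r (gL l Ll)).
have pcP : PC P g.
  move=> s sd sP.
  apply: (@seq_pred_ind V S P (fun s => 0 < dirval s g) d SP _ pcS _ s sd sP).
    by move=> s1 s2 s12; rewrite (dirval_perm g s12).
  move=> r _ _ rS; apply: (pointed_part_ind hK Ku0); first exact: rS.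
  - move=> a v a0 _ v0; rewrite -[_ *: _]addr0 dirval_consl (null _ _ (lineality_linear hK Ku0).1).
    by rewrite addr0; exact: mulr_gt0.
  - move=> x y _ _ x0 y0; rewrite -[x]scale1r dirval_consl mul1r; exact: addr_gt0.
  - move=> v l _ Ll v0; rewrite addrC -[l]scale1r dirval_consl (null _ _ Ll).
    by rewrite mulr0 add0r.
split=> //.
have Bs s := dirform_symbilin s g.
have LB s x y : L x -> dirform s g x y = 0 by exact: dirform_lineality.
(* With positivity known on [P], the reference vector can be replaced freely. *)
have change s u v : size s = k -> (forall w, w \in s -> P w) -> P v ->
    hyperbolic (dirform s g) L u -> hyperbolic (dirform s g) L v.
  move=> sk sP Pv; move/(hyperbolic_change (Bs s) (LB s)); apply.
  exact: (PC_cons pcP sk sP Pv Pv).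
have cons_lin a x y r v w : dirform (a *: x + y :: r) g v w =
    a * dirform (x :: r) g v w + dirform (y :: r) g v w.
  have E z : dirform (z :: r) g v w = dirval [:: z, v, w & r] g.
    by rewrite /dirform /dirval /= (dirderivC w) (dirderivC v).
  by rewrite !E dirval_consl.
have [u1 Su1] : exists u, S u.
  have Pu0 : P u0 by exact: (cone_pointed hK K_proper Ku0 Ku0).
  (* Induction with a predicate independent of the vector: a nonempty pointed part forces an extreme
     vector to exist. *)
  apply: (pointed_part_ind hK Ku0 _ _ _ _ Pu0) => [v Sv|a v _ _|x y _ _ + _|v l _ _] //.
  by exists v.
have L0 : L 0 := (lineality_linear hK Ku0).1.
have nullr l r v w : L l -> dirform (l :: r) g v w = 0.
  move=> Ll; rewrite /dirform /dirval /= (dirderivC w) (dirderivC v).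
  exact: (null l [:: v, w & r] Ll).
move=> s u sk sP Pu.
(* Quantifying over all reference vectors lets the sum case use the form of [a :: r] at [b] and that
   of [b :: r] at [a]. *)
suff H : forall v, P v -> hyperbolic (dirform s g) L v by exact: H.
apply: (@seq_pred_ind V S P (fun s => forall v, P v -> hyperbolic (dirform s g) L v)
  k SP _ _ _ s sk sP).
- move=> s1 s2 s12 h v /h; congr hyperbolic; apply/funext => x; apply/funext => y.
  apply: dirval_perm; rewrite !perm_cons; exact: s12.
- move=> r rk rS v Pv; apply: (change r u1 v rk _ Pv); last exact: (hcS r u1 rk rS Su1).
  by move=> w /rS; exact: SP.
move=> r rk rP rS.
apply: (pointed_part_ind hK Ku0); first exact: rS.
- move=> a v a0 _ hv w Pw; have [ww neg] := hyperbolic_scale a0 (hv w Pw).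
  have -> : dirform (a *: v :: r) g = fun x y => a * dirform (v :: r) g x y.
    apply/funext => x; apply/funext => y.
    by rewrite -[a *: v]addr0 cons_lin (nullr 0) ?addr0 //; exact: L0.
  by split.
- move=> a b Pa Pb ha hb w Pw.
  have Pab : P (a + b).
    exact: (pointed_partD (closure_coneD hK Ku0) Pa Pb.1).
  have rP' v : P v -> forall z, z \in v :: r -> P z.
    by move=> Pv z; rewrite inE => /orP[/eqP->//|/rP].
  have pos x y z : P x -> P y -> P z -> 0 < dirform (x :: r) g y z.
    by move=> Px Py Pz; exact: (@PC_cons P g (x :: r) y z pcP rk (rP' x Px) Py Pz).
  apply: (change (a + b :: r) (a + b) w rk (rP' _ Pab) Pw).
  have -> : dirform (a + b :: r) g =
      fun x y => dirform (a :: r) g x y + dirform (b :: r) g x y.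
    apply/funext => x; apply/funext => y.
    by rewrite -[a]scale1r cons_lin mul1r scale1r.
  apply: hyperbolic_add; [exact: Bs|exact: Bs| | | |exact: ha|exact: hb].
    move=> x; rewrite /dirform /dirval /= (dirderivC b x) (dirderivC a x).
    by rewrite (dirderivC b a).
    exact: ltW (pos _ _ _ Pa Pa Pa).
  exact: ltW (pos _ _ _ Pb Pb Pb).
- move=> v l _ Ll hv w Pw; have [ww neg] := hv w Pw.
  have -> : dirform (v + l :: r) g = dirform (v :: r) g.
    apply/funext => x; apply/funext => y.
    by rewrite -[v]scale1r cons_lin mul1r scale1r (nullr l) // addr0.
  by split.
Qed.

Lemma PC_HC_Lorentzian g : Hspace d K g -> PC P g -> HC P g -> Lorentzian d K g.
Proof.
move=> gH pc hc; split; [by []|exact: gH.1|].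
case=> -[|a [|b s]] // sz sK; have [sk] := eqP sz.
have KP u : K u -> P u by exact: (cone_pointed hK K_proper Ku0).
have sP v : v \in [:: a, b & s] -> P v by move=> vs; exact: (KP v (sK v vs)).
split; first by apply: pc; [rewrite /= sk|exact: sP].
move=> _; apply: (hyperbolic_one_positive_eigenvalue (L := L) (u := a) _ _ _).1.
- exact: dirform_symbilin.
- by move=> x y; exact: dirform_lineality.
rewrite /= drop0; apply: hc; first exact: sk.
  by move=> v vs; apply: sP; rewrite !inE vs !orbT.
by apply: sP; rewrite inE eqxx.
Qed.
End Lorentzian.

(** * Openness of the conditions *)

(** Here [p], [q], [r] are the old values and [a], [b], [c] their changes. In the expanded
    difference the terms linear in the changes cost at most [4 * M * h], the product [b * c] at most
    [h * h <= h], and [a ^+ 2] only helps. *)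
Lemma rcs_perturbation (R : realType) (M h p q r a b c : R) :
  `|p| <= M -> `|q| <= M -> `|r| <= M -> `|a| <= h -> `|b| <= h -> `|c| <= h ->
  h <= 1 -> (4 * M + 2) * h < p ^+ 2 - q * r ->
  (b + q) * (c + r) < (a + p) ^+ 2.
Proof.
move=> pM qM rM ah bh ch h1 lt.
have bnd (x y X Y : R) : `|x| <= X -> `|y| <= Y -> - (X * Y) <= x * y <= X * Y.
  by move=> xX yY; rewrite -ler_norml normrM; apply: ler_pM.
have /andP[ap _] := bnd _ _ _ _ ah pM.
have /andP[_ br] := bnd _ _ _ _ bh rM.
have /andP[_ cq] := bnd _ _ _ _ ch qM.
have /andP[_ bc] := bnd _ _ _ _ bh ch.
have h0 : 0 <= h := le_trans (normr_ge0 _) ah.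
have hh : h * h <= h by rewrite -[leRHS]mulr1 ler_wpM2l.
have aa := sqr_ge0 a.
rewrite -subr_gt0.
have -> : (a + p) ^+ 2 - (b + q) * (c + r) =
  (p ^+ 2 - q * r) + (a ^+ 2 + 2 * (a * p) - b * r - c * q - b * c) by ring.
rewrite [h * M]mulrC in ap br cq.
lra.
Qed.

Section Openness.
Variables (R : realType) (n k : nat) (K : set 'rV[R]_n).
Local Notation V := 'rV[R]_n.
Local Notation L := (lineality K).
Local Notation U := (unit_pointed K).
Local Notation d := k.+2.
Implicit Types (f g : mpoly n R) (u v w x y : V) (s r : seq V).

Lemma row_nth_seq N (s : seq V) : size s = N ->
  [seq (\row_(i < N) nth 0 s i : 'rV[V]_N) ord0 i | i <- enum 'I_N] = s.
Proof.
move=> sN; apply: (@eq_from_nth _ 0); rewrite size_map size_enum_ord // => i iN.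
rewrite (nth_map (Ordinal iN)) ?size_enum_ord // mxE.
by rewrite nth_enum_ord.
Qed.

Lemma compact_unit_pointed : compact U.
Proof.
by apply: compact_unit_vectors; [exact: closed_unit_pointed|move=> x []].
Qed.

Lemma continuous_dirval_entries N (I : Type) (t : seq I) (G : I -> 'rV[V]_N -> V) f :
  (forall i, (exists j, G i = fun M => M ord0 j) \/ (exists v, G i = fun=> v)) ->
  continuous (fun M : 'rV[V]_N => dirval [seq G i M | i <- t] f).
Proof.
move=> hG; have E M : [seq G i M | i <- t] = [seq h M | h <- [seq G i | i <- t]].
  by rewrite -map_comp.
under eq_fun do rewrite E.
apply: continuous_dirval => h hin.
have [i ->] : exists i, h = G i.
  by elim: t hin {E} => //= i t IH [<-|/IH //]; exists i.
have [[j ->] l|[v ->] l] := hG i; last exact: cst_continuous.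
move=> M; apply: (@continuous_comp _ _ _ (fun M : 'rV[V]_N => M ord0 j) (fun v : V => v 0 l)).
  exact: continuous_entry.
exact: continuous_coord.
Qed.

Lemma PC_uniform f : PC k U f ->
  exists2 e : R, 0 < e &
    forall s, size s = d -> (forall v, v \in s -> U v) -> e <= dirval s f.
Proof.
move=> pc.
pose F (M : 'rV[V]_d) := dirval [seq M ord0 i | i <- enum 'I_d] f.
have Fc : continuous F.
  by apply: (continuous_dirval_entries (G := fun i M => M ord0 i)) => i; left; exists i.
have [|e e0 he] := @compact_uniform_positive R V d (fun=> U) F (fun=> compact_unit_pointed) Fc.
  move=> M MU; apply: pc; first by rewrite size_map size_enum_ord.
  by move=> v /mapP[i _ ->]; exact: MU.
exists e => // s sd sU; have := he (\row_i nth 0 s i); rewrite /F row_nth_seq //; apply.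
by move=> i; rewrite mxE; apply: sU; apply: mem_nth; rewrite sd.
Qed.

Lemma HC_uniform f u : U u -> HC k K U f ->
  exists2 e : R, 0 < e &
    forall x s, dot x x = 1 -> dot u x = 0 -> (forall w, L w -> dot w x = 0) ->
      size s = k -> (forall v, v \in s -> U v) ->
      e <= dirform s f u x ^+ 2 - dirform s f x x * dirform s f u u.
Proof.
move=> Uu hc.
pose X : set V := [set x | dot x x = 1] `&` ([set x | dot u x = 0] `&`
    \bigcap_(w in L) [set x | dot w x = 0]).
have Xc : compact X.
  apply: compact_unit_vectors => [|x []//].
  apply: closedI; first exact: closed_unit_sphere.
  apply: closedI; first exact: closed_dot0.
  by apply: closed_bigI => l _; exact: closed_dot0.
(* Entry zero of the row carries the test vector [x], the other [k] entries the derivative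
   directions. *)
pose A (i : 'I_k.+1) := if i == ord0 then X else U.
have Ac i : compact (A i) by rewrite /A; case: ifP => _; [exact: Xc|exact: compact_unit_pointed].
pose tl (M : 'rV[V]_k.+1) := [seq M ord0 (lift ord0 i) | i <- enum 'I_k].
pose F M := dirform (tl M) f u (M ord0 ord0) * dirform (tl M) f u (M ord0 ord0)
  - dirform (tl M) f (M ord0 ord0) (M ord0 ord0) * dirform (tl M) f u u.
(* Codes for the arguments: [None] is the fixed [u], [Some None] the test vector, [Some (Some i)] a
   derivative direction. *)
pose G (o : option (option 'I_k)) (M : 'rV[V]_k.+1) :=
  if o is Some o' then (if o' is Some i then M ord0 (lift ord0 i) else M ord0 ord0) else u.
have Gc o1 o2 : continuous (fun M => dirform (tl M) f (G o1 M) (G o2 M)).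
  have E M : dirform (tl M) f (G o1 M) (G o2 M) =
      dirval [seq G o M | o <- [:: o1, o2 & [seq Some (Some i) | i <- enum 'I_k]]] f.
    by rewrite /dirform /= -map_comp.
  under eq_fun do rewrite E.
  apply: continuous_dirval_entries => -[[i|]|]; [left|left|right].
  - by exists (lift ord0 i).
  - by exists ord0.
  - by exists u.
have Fc : continuous F.
  by move=> M; exact: (cvgB (cvgM (Gc None (Some None) M) (Gc None (Some None) M))
    (cvgM (Gc (Some None) (Some None) M) (Gc None None M))).
have [|e e0 he] := @compact_uniform_positive R V k.+1 A F Ac Fc.
  move=> M MA; have [x1 [ux xL]] : X (M ord0 ord0) by have := MA ord0; rewrite /A eqxx.
  rewrite subr_gt0 -expr2; apply: (@hyperbolic_rcs_lt _ _ _ L);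
    [exact: dirform_symbilin| |exact: x1|exact: ux|exact: xL].
  apply: hc; [by rewrite size_map size_enum_ord| |exact: Uu].
  by move=> v /mapP[i _ ->]; exact: (MA (lift ord0 i)).
exists e => // x s x1 ux xL sk sU.
pose M : 'rV[V]_k.+1 := \row_i nth 0 (x :: s) i.
have M0 : M ord0 ord0 = x by rewrite mxE.
have Mtl : tl M = s.
  rewrite -[RHS](row_nth_seq sk); apply: eq_map => i.
  by rewrite !mxE lift0.
have := he M; rewrite /F M0 Mtl -expr2; apply => i; rewrite /A.
have [->|i0] := eqVneq i ord0; first by rewrite M0; split; [exact: x1|split; [exact: ux|exact: xL]].
rewrite mxE; case: (unliftP ord0 i) i0 => [j ->|->]; last by rewrite eqxx.
by move=> _; rewrite lift0 /=; apply: sU; apply: mem_nth; rewrite sk.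
Qed.

Lemma PC_HC_open f u : linear_set L -> U u -> PC k U f -> HC k K U f ->
  exists2 e : R, 0 < e & forall g, Hspace d K g ->
    (forall m, `|mcoeff m g - mcoeff m f| < e) ->
    PC k U g /\ forall s, size s = k -> (forall v, v \in s -> U v) ->
      hyperbolic (dirform s g) L u.
Proof.
move=> LL Uu pc hc.
have [e1 e1p he1] := PC_uniform pc.
have [e2 e2p he2] := HC_uniform Uu hc.
have [b bp fb] := mpoly_bounded f.
(* The factor of [dirval_bound] for [d] unit directions, so that [M] bounds all such derivatives of
   [f]. *)
pose c : R := ((n * d.+1) ^ d)%:R.
have c0 : 0 <= c by rewrite ler0n.
pose M := c * b.
have M0 : 0 <= M by rewrite mulr_ge0 // ltW.
have Mp : 0 < 4 * M + 3 by lra.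
(* The allowed change of a derivative: [h < e1] preserves positivity, and [(4 * M + 2) * h < e2]
   preserves the reverse Cauchy-Schwarz inequality. *)
pose h := Num.min 1 (Num.min (e1 / 2) (e2 / (4 * M + 3))).
have h0 : 0 < h by rewrite !lt_min ltr01 !divr_gt0.
have h1 : h <= 1 by rewrite ge_min lexx.
have he1' : h < e1.
  have : h <= e1 / 2 by rewrite !ge_min lexx orbT.
  lra.
have he2' : (4 * M + 2) * h < e2.
  have : h <= e2 / (4 * M + 3) by rewrite !ge_min lexx !orbT.
  rewrite ler_pdivlMr //; lra.
have c1 : 0 < c + 1 by lra.
exists (h / (c + 1)); first exact: divr_gt0.
move=> g gH gf.
have unit_coords s : (forall v, v \in s -> dot v v = 1) ->
    forall v, v \in s -> forall i, `|v 0 i| <= 1.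
  by move=> s1 v vs i; apply: unit_coord_le1; exact: s1.
have fM s : size s = d -> (forall v, v \in s -> dot v v = 1) -> `|dirval s f| <= M.
  by move=> sd s1; have := dirval_bound fb (unit_coords _ s1); rewrite sd.
have gfh s : size s = d -> (forall v, v \in s -> dot v v = 1) -> `|dirval s (g - f)| <= h.
  move=> sd s1.
  have gfb m : `|mcoeff m (g - f)| <= h / (c + 1) by rewrite mcoeffB ltW.
  have := dirval_bound gfb (unit_coords _ s1); rewrite sd => /le_trans; apply.
  rewrite -/c mulrCA -[leRHS]mulr1 ler_wpM2l ?ltW // ltr_pdivrMr //; lra.
have gE s : dirval s g = dirval s (g - f) + dirval s f.
  by have := dirval_poly s 1 (g - f) f; rewrite scale1r mul1r subrK.
have pcg : PC k U g.
  move=> s sd sU; rewrite gE.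
  have s1 v : v \in s -> dot v v = 1 by move=> /sU [].
  have := gfh s sd s1; rewrite ler_norml => /andP[lo _].
  have := he1 s sd sU; lra.
split; first exact: pcg.
move=> s sk sU; have [_ u1 uL] := Uu.
apply: hyperbolic_of_rcs_lt; [exact: dirform_symbilin|exact: LL| |exact: u1|exact: uL| |].
- by move=> x y Lx; exact: (dirform_lineality s y gH Lx).
- exact: (PC_cons pcg sk sU Uu Uu).
move=> x x1 ux xL.
have s1 y z : dot y y = 1 -> dot z z = 1 -> forall v, v \in [:: y, z & s] -> dot v v = 1.
  by move=> y1 z1 v; rewrite !inE => /orP[/eqP->|/orP[/eqP->|/sU[]]].
have sz y z : size [:: y, z & s] = d by rewrite /= sk.
have bound y z (y1 : dot y y = 1) (z1 : dot z z = 1) :=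
  (fM _ (sz y z) (s1 y z y1 z1), gfh _ (sz y z) (s1 y z y1 z1)).
have [pM ah] := bound u x u1 x1.
have [qM bh] := bound x x x1 x1.
have [rM ch] := bound u u u1 u1.
rewrite /dirform !gE; apply: (rcs_perturbation pM qM rM ah bh ch h1).
by apply: lt_le_trans he2' _; exact: he2.
Qed.
End Openness.

(** * Interior points satisfy the conditions *)

Section Interior.
Variables (R : realType) (n k : nat) (K : set 'rV[R]_n).
Hypothesis hK : open_convex_cone K.
Variable u0 : 'rV[R]_n.
Hypothesis Ku0 : K u0.
Local Notation V := 'rV[R]_n.
Local Notation L := (lineality K).
Local Notation C := (closure K).
Local Notation S := (extreme_vectors_mod K).
Local Notation d := k.+2.
Implicit Types (f g : mpoly n R) (u v w x y : V) (s r : seq V).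

Lemma continuous_ge0_limit (h : R -> R) :
  continuous h -> (forall t, 0 < t -> 0 <= h t) -> 0 <= h 0.
Proof.
move=> hc hpos; rewrite leNgt; apply/negP => h0.
have /nbhs_ballP[e /= e0 he] : nbhs (0 : R) (h @^-1` [set y | y < 0]).
  by apply: hc; exact: lt_nbhsl.
have e2 : 0 < e / 2 by lra.
have : ball 0 e (e / 2) by rewrite /ball /= sub0r normrN gtr0_norm //; lra.
by move=> /he /=; rewrite ltNge hpos.
Qed.

(** Moves the closure into the open cone for [t > 0]; weak inequalities reach the boundary as [t]
    tends to 0. *)
Definition shift (t : R) v := v + t *: u0.

Lemma shift0 v : shift 0 v = v.
Proof. by rewrite /shift scale0r addr0. Qed.

Lemma shift_cone t v : 0 < t -> C v -> K (shift t v).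
Proof. by move=> t0 /(closureP hK Ku0); apply. Qed.

Lemma continuous_dirval_shift (I : Type) (l : seq I) (G : I -> R -> V) g :
  (forall i, (exists v, G i = fun=> v) \/ (exists v, G i = shift^~ v)) ->
  continuous (fun t => dirval [seq G i t | i <- l] g).
Proof.
move=> hG; have E t : [seq G i t | i <- l] = [seq h t | h <- [seq G i | i <- l]].
  by rewrite -map_comp.
under eq_fun do rewrite E.
apply: continuous_dirval => h hin j.
have [i ->] : exists i, h = G i.
  by elim: l hin {E} => //= i l IH [<-|/IH //]; exists i.
have [[v ->]|[v ->]] := hG i; first exact: cst_continuous.
move=> t; rewrite /shift.
apply: (@continuous_comp _ _ _ (fun t : R => v + t *: u0) (fun x : V => x 0 j)).
  exact: line_continuous.
exact: continuous_coord.
Qed.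

Lemma Lorentzian_closure_ge0 g s : Lorentzian d K g -> size s = d ->
  (forall v, v \in s -> C v) -> 0 <= dirval s g.
Proof.
move=> [_ _ gL] sd sC.
have := @continuous_ge0_limit (fun t => dirval [seq shift t v | v <- s] g).
have -> : [seq shift 0 v | v <- s] = s by rewrite -[RHS]map_id; exact: (eq_map shift0).
apply; first by apply: (continuous_dirval_shift (G := fun v t => shift t v)) => v; right; exists v.
move=> t t0; have sz : size [seq shift t v | v <- s] == d by rewrite size_map sd.
have [|pos _] := gL (Tuple sz); last exact: ltW pos.
by move=> v /mapP[w ws ->]; apply: shift_cone; [exact: t0|exact: sC].
Qed.

(** The reverse Cauchy-Schwarz inequality is a weak inequality between continuous functions, so it
    passes to the limit from shifted directions, where it follows from the eigenvalue condition. *)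
Lemma Lorentzian_closure_rcs g s u x : Lorentzian d K g -> size s = k ->
  (forall v, v \in s -> C v) -> C u ->
  dirform s g x x * dirform s g u u <= dirform s g u x ^+ 2.
Proof.
move=> [_ _ gL] sk sC Cu.
pose G (o : option (option V)) (t : R) :=
  if o is Some o' then (if o' is Some v then shift t v else shift t u) else x.
pose B t := dirform [seq shift t v | v <- s] g.
have Bc o1 o2 : continuous (fun t => B t (G o1 t) (G o2 t)).
  have E t : B t (G o1 t) (G o2 t) =
      dirval [seq G o t | o <- [:: o1, o2 & [seq Some (Some v) | v <- s]]] g.
    by rewrite /B /dirform /= -map_comp.
  under eq_fun do rewrite E.
  by apply: continuous_dirval_shift => -[[v|]|]; [right; exists v|right; exists u|left; exists x].
pose h t := B t (shift t u) x * B t (shift t u) x - B t x x * B t (shift t u) (shift t u).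
have hc : continuous h.
  by move=> t; exact: (cvgB (cvgM (Bc (Some None) None t) (Bc (Some None) None t))
    (cvgM (Bc None None t) (Bc (Some None) (Some None) t))).
rewrite -subr_ge0 expr2.
have B0 : B 0 = dirform s g.
  by rewrite /B; congr dirform; rewrite -[RHS]map_id; exact: (eq_map shift0).
have := continuous_ge0_limit hc; rewrite /h B0 shift0; apply => t t0.
set ut := shift t u.
have Kut : K ut by exact: shift_cone.
have stK v : v \in [seq shift t v | v <- s] -> K v.
  by move=> /mapP[w ws ->]; apply: shift_cone; [exact: t0|exact: sC].
have sz : size [:: ut, ut & [seq shift t v | v <- s]] == d by rewrite /= size_map sk.
have [|pos /(_ isT) /= ope] := gL (Tuple sz).
  by move=> v; rewrite !inE => /orP[/eqP->|/orP[/eqP->|/stK]].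
rewrite drop0 in ope.
(* With [setT] in place of [L] only nonpositivity on the hyperplane remains to be shown. *)
rewrite subr_ge0 -expr2; apply: (@hyperbolic_rcs _ _ _ setT); first exact: dirform_symbilin.
split; first exact: pos.
move=> z Bz; split=> //.
exact: (one_positive_eigenvalue_nonpos (dirform_symbilin _ _) ope pos Bz).
Qed.

Lemma interior_absorbs f g : interior_in_Hspace d K (Lorentzian d K) f ->
  Hspace d K g ->
  exists2 e : R, 0 < e & forall t, `|t| < e -> Lorentzian d K (t *: g + f).
Proof.
move=> [fH [e e0 he]] gH; have [c c0 gc] := mpoly_bounded g.
exists (e / c); first exact: divr_gt0.
move=> t te; apply: he; first exact: Hspace_lin.
move=> m; rewrite mcoeffD mcoeffZ addrK normrM.
apply: le_lt_trans (_ : `|t| * c < e); first by rewrite ler_wpM2l.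
by rewrite -ltr_pdivlMr.
Qed.

(** For [y] orthogonal to [L] but to no [z] in [s], the mixed derivative of the power of its linear
    form is a factorial times the product of the nonzero [dot y z]. *)
Lemma separating_power s : size s = d ->
  (forall z, z \in s -> z != 0 /\ forall w, L w -> dot z w = 0) ->
  exists2 g, Hspace d K g & dirval s g != 0.
Proof.
move=> sd sL; have [y yL ys] := orthogonal_generic sL.
exists (linear_form y ^+ d); first exact: linear_formX_Hspace.
rewrite -{1}sd dirval_linear_formX mulf_neq0 ?pnatr_eq0 -?lt0n ?fact_gt0 //.
by rewrite prodf_seq_neq0; apply/allP => z /ys.
Qed.

Lemma extreme_vectors_mod_orthogonal v : S v -> v != 0 /\ forall w, L w -> dot v w = 0.
Proof.
move=> [[v1 _] vL]; split; last exact: vL.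
apply/eqP => v0; move: v1; rewrite v0 (symbilin0l (@dot_symbilin R n)) => /esym/eqP.
by rewrite oner_eq0.
Qed.

Lemma interior_PC f : interior_in_Hspace d K (Lorentzian d K) f -> PC k S f.
Proof.
move=> fint s sd sS.
have sC v : v \in s -> C v by move=> /sS [[_ []]].
have [|g gH gs] := separating_power sd.
  by move=> z /sS; exact: extreme_vectors_mod_orthogonal.
have [e e0 he] := interior_absorbs fint gH.
(* An affine function of [t] with nonzero slope that is nonnegative on both sides of 0 is positive
   at 0. *)
have ge0 t : `|t| < e -> 0 <= t * dirval s g + dirval s f.
  by move=> /he gt; rewrite -dirval_poly; exact: (Lorentzian_closure_ge0 gt sd sC).
have e2 : `|e / 2| < e by rewrite gtr0_norm; lra.
have h1 := ge0 (e / 2) e2; have := ge0 (- (e / 2)); rewrite normrN => /(_ e2) h2.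
have [lt|lt] : 0 < (e / 2) * dirval s g \/ (e / 2) * dirval s g < 0.
  have : (e / 2) * dirval s g != 0 by rewrite mulf_neq0 // gt_eqF //; lra.
  by case: (ltgtP 0) => // *; [left|right].
  lra.
lra.
Qed.

Lemma interior_HC f : interior_in_Hspace d K (Lorentzian d K) f -> HC k K S f.
Proof.
move=> fint s u sk sS Su.
have LL := lineality_linear hK Ku0.
have fH := fint.1.
have sC v : v \in s -> C v by move=> /sS [[_ []]].
have Cu : C u by case: Su => [[_ []]].
have Bs := dirform_symbilin s f; have BC := Bs.1.
have LB x y : L x -> dirform s f x y = 0 by move=> Lx; exact: (dirform_lineality s y fH Lx).
have Buu : 0 < dirform s f u u by exact: (PC_cons (interior_PC fint) sk sS Su Su).
split=> // x Bux.
have [e0 e0p he0] := interior_absorbs fint fH.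
have fL : Lorentzian d K f.
  have [_ [e ep he]] := fint; apply: he => // m.
  by rewrite subrr normr0.
split.
  have := Lorentzian_closure_rcs x fL sk sC Cu; rewrite Bux expr0n /=.
  by rewrite pmulr_lle0.
(* The component [z] of [x] orthogonal to [L] is again null and [B]-orthogonal to [u]; if it is
   nonzero, a perturbation detecting it gives a contradiction. *)
move=> Bxx; have [l Ll xl] := orthogonal_projection x LL.
have [z0|z0] := eqVneq (x - l) 0; first by rewrite -(subrK l x) z0 add0r.
set z := x - l in xl z0.
have zE : z = (-1) *: l + x by rewrite scaleN1r addrC.
have Bzz : dirform s f z z = 0.
  rewrite zE Bs.2 LB // mulr0 add0r BC Bs.2 LB // mulr0 add0r; exact: Bxx.
have Buz : dirform s f u z = 0.
  by rewrite BC zE Bs.2 LB // mulr0 add0r BC.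
have [||g gH gz] := @separating_power [:: z, z & s].
- by rewrite /= sk.
- move=> y; rewrite !inE orbA orbb => /orP[/eqP ->|/sS]; first by split.
  exact: extreme_vectors_mod_orthogonal.
exfalso.
have [e ep he] := interior_absorbs fint gH.
pose p := dirform s g z z; pose q := dirform s g u u; pose r := dirform s g u z.
have p0 : p != 0 by exact: gz.
have np : 0 < `|p| by rewrite normr_gt0.
pose b := dirform s f u u.
(* Perturb by [(t * p) *: g], whose value at [z, z] is [t * p ^+ 2 > 0] whatever the sign of [p].
   The reverse Cauchy-Schwarz inequality divided by [t * p ^+ 2] gives the bound, which fails for
   small [t]. *)
have key t : 0 < t -> t * `|p| < e -> b <= t * (r ^+ 2 - p * q).
  move=> t0 tp; have tpe : `|t * p| < e by rewrite normrM gtr0_norm.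
  have := Lorentzian_closure_rcs z (he _ tpe) sk sC Cu.
  rewrite /dirform !dirval_poly -!/(dirform _ _ _ _) Bzz Buz !addr0.
  rewrite -/p -/q -/r -/b => le.
  have tp2 : 0 < t * p ^+ 2 by rewrite mulr_gt0 // exprn_even_gt0.
  rewrite -(ler_pM2l tp2) -subr_ge0; move: le; rewrite -subr_ge0; congr (_ <= _).
  ring.
pose M := `|r ^+ 2 - p * q| + 1.
have M0 : 0 < M by rewrite ltr_wpDl.
(* The first bound keeps the perturbation admissible, the second makes [t * M < b]. *)
pose t := Num.min (e / (2 * `|p|)) (b / (2 * M)).
have t0 : 0 < t by rewrite lt_min !divr_gt0 // mulr_gt0.
have te : t * `|p| < e.
  have : t <= e / (2 * `|p|) by rewrite ge_min lexx.
  rewrite ler_pdivlMr ?mulr_gt0 //; lra.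
have tb : t * M < b.
  have : t <= b / (2 * M) by rewrite ge_min lexx orbT.
  rewrite ler_pdivlMr ?mulr_gt0 //; rewrite -/b in Buu; lra.
have := key t t0 te.
have : t * (r ^+ 2 - p * q) <= t * M.
  by rewrite ler_pM2l // (le_trans (ler_norm _)) // lerDl.
lra.
Qed.
End Interior.

Theorem theorem8p14 (R : realType) (n d : nat) (K : set 'rV[R]_n)
    (f : mpoly n R)
    (hK : open_convex_cone K) (hKproper : K <> setT)
    (hd : (2 <= d)%N) (hf : homogeneous d f) (hfH : Hspace d K f) :
  interior_in_Hspace d K (Lorentzian d K) f <->
  (forall v : d.-tuple 'rV[R]_n,
     (forall u, u \in v -> extreme_vectors_mod K u) ->
     0 < dirval v f /\
     (one_positive_eigenvalue (dirform (drop 2 v) f) /\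
      form_kernel (dirform (drop 2 v) f) = lineality K)).
Proof.
case: d hd hf hfH => [|[|k]] // _ hf hfH.
(* For an empty cone both sides hold vacuously: the closure is empty, and every tuple has a head
   because the degree is positive. *)
have [[u0 Ku0]|K0] := pselect (K !=set0); last first.
  have {}K0 : K = set0 by apply/eqP/negPn/negP => /set0P.
  have clK x : ~ closure K x by rewrite K0 closure0.
  split=> _.
    move=> [[|a s] //= sz] /(_ a); rewrite mem_head => /(_ isT) [[_ [Ca _ _]]].
    by case: (clK a).
  split=> //; exists 1 => // g [gh _] _; split=> //.
  move=> [[|a s] //= sz] /(_ a); rewrite mem_head => /(_ isT).
  by rewrite K0.
have LL := lineality_linear hK Ku0.
have LB s x y : lineality K x -> dirform s f x y = 0.
  by move=> Lx; exact: (dirform_lineality s y hfH Lx).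
split=> [fint|rhs].
  have pc := interior_PC hK Ku0 fint; have hc := interior_HC hK Ku0 fint.
  move=> [[|a [|b s]] //= sz] vS; have [sk] := eqP sz.
  have sS v : v \in s -> extreme_vectors_mod K v.
    by move=> vs; apply: vS; rewrite !inE vs !orbT.
  have aS : extreme_vectors_mod K a by apply: vS; rewrite mem_head.
  split; first by apply: pc; [exact: (eqP sz)|exact: vS].
  rewrite drop0.
  exact: (hyperbolic_one_positive_eigenvalue (dirform_symbilin s f) (LB s) (hc s a sk sS aS)).
have pcS : PC k (extreme_vectors_mod K) f.
  by move=> s /eqP sd sS; exact: (rhs (Tuple sd) sS).1.
have hcS : HC k K (extreme_vectors_mod K) f.
  move=> s u sk sS Su; have sz : size [:: u, u & s] == k.+2 by rewrite /= sk.
  have [|pos] := rhs (Tuple sz).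
    by move=> v; rewrite !inE => /orP[/eqP->|/orP[/eqP->|/sS]].
  rewrite /= drop0 => -[ope ker].
  exact: (one_positive_eigenvalue_hyperbolic (dirform_symbilin s f) ope ker pos).
have [pc hc] := PC_HC_extend hK hKproper Ku0 hfH pcS hcS.
have UP v : unit_pointed K v -> pointed_part (closure K) v by exact: unit_pointed_part.
have [u1 Uu1] : exists u, unit_pointed K u.
  apply: (pointed_part_ind hK Ku0 _ _ _ _ (cone_pointed hK hKproper Ku0 Ku0))
    => [v Sv|a v _ _|x y _ _ + _|v l _ _] //.
  by exists v; exact: extreme_vectors_mod_unit.
(* Openness is used on the compact section; for a nearby [g] the conditions are then restricted to
   the extreme vectors and extended back to the cone. *)
have [||e e0 he] := @PC_HC_open R n k K f u1 LL Uu1.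
- by move=> s sd sU; apply: pc; [exact: sd|move=> v /sU /UP].
- by move=> s u sk sU Uu; apply: hc; [exact: sk|move=> v /sU /UP|exact: UP].
split=> //; exists e => // g gH gf; have [pcU hcU] := he g gH gf.
have SU v : extreme_vectors_mod K v -> unit_pointed K v by exact: extreme_vectors_mod_unit.
have pcSg : PC k (extreme_vectors_mod K) g.
  by move=> s sd sS; apply: pcU; [exact: sd|move=> v /sS /SU].
have hcSg : HC k K (extreme_vectors_mod K) g.
  (* The neighbourhood was obtained for the single reference vector [u1]. *)
  move=> s u sk sS Su; apply: (@hyperbolic_change _ _ _ _ u1).
  - exact: dirform_symbilin.
  - by move=> x y Lx; exact: (dirform_lineality s y gH Lx).
  - by apply: hcU; [exact: sk|move=> v /sS /SU].
  - exact: (PC_cons pcSg sk sS Su Su).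
have [pcP hcP] := PC_HC_extend hK hKproper Ku0 gH pcSg hcSg.
exact: (PC_HC_Lorentzian hK hKproper Ku0 gH pcP hcP).
Qed.
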